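(* Any algebraic subgroup of $\mathrm{Jonq}$ isomorphic to the additive algebraic group $(\mathbb C,+)$ is conjugate in $\mathrm{Jonq}$ either to $\mathbb U_1:=\{(x+c,y):c\in\mathbb C\}$ or to $\mathbb U_2:=\{(x,y+c):c\in\mathbb C\}$.
   Context: $\mathrm{Bir}(\mathbb P^2)$ is the group of birational transformations of the complex projective plane, identified with $\mathrm{Bir}(\mathbb A^2)$ via $(x,y)\mapsto[x:y:1]$. Zariski topology. For an irreducible complex algebraic variety $A$, a morphism $A\to\mathrm{Bir}(\mathbb P^2)$ is a map $a\mapsto f_a$ arising from an $A$-birational map $f$ of $A\times\mathbb P^2$ that induces an isomorphism $U\to V$ between open subsets $U,V\subseteq A\times \mathbb P^2$ whose projections to $A$ are both surjective, where $f_a$ is $w\dashrightarrow p_2(f(a,w))$ and $p_2$ is the second projection. A subset $F\subseteq\mathrm{Bir}(\mathbb P^2)$ is closed if its preimage under every such morphism (for every $A$) is closed in $A$. An algebraic subgroup of $\mathrm{Bir}(\mathbb P^2)$ is a closed subgroup whose elements have bounded degree; it carries a natural structure of algebraic group. $\mathrm{Jonq}$ is the closed subgroup of $\mathrm{Bir}(\mathbb P^2)$ consisting of the maps $(x,y)\dashrightarrow\left(\frac{\alpha(y)x+\beta(y)}{\gamma(y)x+\delta(y)},\frac{ay+b}{cy+d}\right)$ with $\begin{pmatrix}\alpha&\beta\\ \gamma&\delta\end{pmatrix}\in\mathrm{PGL}_2(\mathbb C(y))$ and $\begin{pmatrix}a&b\\ c&d\end{pmatrix}\in\mathrm{PGL}_2(\mathbb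 C)$. *)

(* Defs.v *)
From HB Require Import structures.
From mathcomp Require Import all_boot all_order all_algebra.
From mathcomp Require Import boolp classical_sets functions reals topology_structure.
From mathcomp Require Import complex.
From mathcomp Require Import generic_quotient mpoly.

Set Implicit Arguments.
Unset Strict Implicit.
Unset Printing Implicit Defensive.

Import GRing.Theory.
Local Open Scope classical_set_scope.
Local Open Scope quotient_scope.
Local Open Scope ring_scope.

(* A rational map [F_0 : F_1 : F_2] of P^2 is given by a nonzero triple of
   homogeneous polynomials of the same degree in the homogeneous coordinates
   X_0 = x, X_1 = y, X_2 = z; proportional triples give the same map.  Bir K is
   the group of those that have an inverse, f * g being f after g. *)
Section Triples.
Context (K : fieldType).

Definition triple := 3.-tuple {mpoly K[3]}.
Implicit Types F G H : triple.

Definition homogeneous_triple (d : nat) F := forall i, tnth F i \is d.-homog.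
Definition nonzero_triple F := exists i, tnth F i != 0.
Definition proportional F G := forall i j, tnth F i * tnth G j = tnth F j * tnth G i.
Definition comp_triple F G : triple := [tuple tnth F i \mPo G | i < 3].
Definition id_triple : triple := [tuple 'X_i | i < 3].

Definition inverse_triples F G :=
  nonzero_triple (comp_triple F G) /\ proportional (comp_triple F G) id_triple.

Lemma proportional_refl F : proportional F F.
Proof. by move=> i j; rewrite mulrC. Qed.

Lemma proportional_sym F G : proportional F G -> proportional G F.
Proof. by move=> h i j; rewrite mulrC -h mulrC. Qed.

Lemma proportional_trans G F H : nonzero_triple G ->
  proportional F G -> proportional G H -> proportional F H.
Proof.
move=> [k Gk] FG GH i j; apply: (mulIf Gk).
by rewrite mulrAC (FG i k) -mulrA (GH i j) mulrA (FG k j) mulrAC.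
Qed.

Lemma comp_tripleA F G H :
  comp_triple F (comp_triple G H) = comp_triple (comp_triple F G) H.
Proof.
apply: eq_from_tnth => i; rewrite !tnth_mktuple.
rewrite [tnth F i \mPo G]comp_mpolyE raddf_sum comp_mpolyE; apply: eq_bigr => m _ /=.
rewrite linearZ /= rmorph_prod; congr (_ *: _); apply: eq_bigr => j _.
by rewrite rmorphXn /= tnth_mktuple.
Qed.

Lemma comp_triple1 F : comp_triple F id_triple = F.
Proof. by apply: eq_from_tnth => i; rewrite tnth_mktuple comp_mpoly_id. Qed.

Lemma comp_triple1l F : comp_triple id_triple F = F.
Proof. by apply: eq_from_tnth => i; rewrite !tnth_mktuple comp_mpolyXU -tnth_nth. Qed.

Lemma homogeneous_id : homogeneous_triple 1 id_triple.
Proof. by move=> i; rewrite tnth_mktuple dhomogX /= mdeg1. Qed.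

Lemma X_neq0 (k : 'I_3) : 'X_k != 0 :> {mpoly K[3]}.
Proof. by rewrite -msupp_eq0 msuppX. Qed.

Lemma nonzero_id : nonzero_triple id_triple.
Proof. by exists ord0; rewrite tnth_mktuple X_neq0. Qed.

Lemma homogeneous_comp d e F G : homogeneous_triple d F -> homogeneous_triple e G ->
  homogeneous_triple (d * e) (comp_triple F G).
Proof.
move=> hF hG i; rewrite tnth_mktuple comp_mpolyE big_seq.
apply: rpred_sum => m mF; apply: rpredZ.
rewrite -(dhomog_mf (hF i) mF) /= mdegE mulnC big_distrr /=.
by elim/big_ind2: _ => [|p a q b|j _]; [exact: dhomog1|exact: dhomogM|exact/dhomogMn/hG].
Qed.

Lemma comp_homog_scale d p (c : {mpoly K[3]}) G G' : p \is d.-homog ->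
  (forall i, tnth G' i = c * tnth G i) -> p \mPo G' = c ^+ d * (p \mPo G).
Proof.
move=> hp hG; rewrite !comp_mpolyE mulr_sumr; apply: eq_big_seq => m mp.
rewrite -scalerAr; congr (_ *: _).
under eq_bigr do rewrite hG exprMn.
rewrite big_split /= prodrXr; congr (c ^+ _ * _).
by rewrite -(dhomog_mf hp mp) /= mdegE.
Qed.

Lemma proportional_compl F F' G :
  proportional F F' -> proportional (comp_triple F G) (comp_triple F' G).
Proof. by move=> h i j; rewrite !tnth_mktuple -!rmorphM /= h. Qed.

Lemma proportional_compr d F G G' : homogeneous_triple d F -> nonzero_triple G' ->
  proportional G G' -> proportional (comp_triple F G) (comp_triple F G').
Proof.
move=> hF [k Gk] GG i j; rewrite !tnth_mktuple.
have E l : tnth G' k ^+ d * (tnth F l \mPo G) = tnth G k ^+ d * (tnth F l \mPo G').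
  rewrite -(@comp_homog_scale d _ _ _ [tuple tnth G' k * tnth G a | a < 3] (hF l)); last first.
    by move=> a; rewrite tnth_mktuple.
  rewrite -(@comp_homog_scale d _ _ _ [tuple tnth G' k * tnth G a | a < 3] (hF l)) //.
  by move=> a; rewrite tnth_mktuple mulrC GG.
apply: (mulfI (expf_neq0 d Gk)).
by rewrite !mulrA !E -!mulrA [X in _ * X]mulrC.
Qed.

Lemma nonzero_comp d F G H : homogeneous_triple d F -> nonzero_triple F ->
  inverse_triples G H -> nonzero_triple (comp_triple F G).
Proof.
move=> hF [i Fi] [[k GHk] GH]; exists i; apply: contra_neq Fi => FG0.
rewrite tnth_mktuple in FG0.
have E l : tnth (comp_triple G H) k ^+ d * tnth F l =
    'X_k ^+ d * (tnth F l \mPo (comp_triple G H)).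
  pose T : triple := [tuple tnth (comp_triple G H) k * 'X_a | a < 3].
  transitivity (tnth F l \mPo T).
    rewrite (@comp_homog_scale d _ (tnth (comp_triple G H) k) id_triple T (hF l)).
      by rewrite comp_mpoly_id.
    by move=> a; rewrite !tnth_mktuple.
  apply: comp_homog_scale => // a.
  by have := GH k a; rewrite !tnth_mktuple => ->; rewrite mulrC.
have := E i; have -> : tnth F i \mPo comp_triple G H = 0.
  have := congr1 (fun T => tnth T i) (comp_tripleA F G H).
  by rewrite /comp_triple !tnth_mktuple FG0 comp_mpoly0.
rewrite mulr0 => /eqP; rewrite mulf_eq0 expf_eq0 (negbTE GHk) andbF /=.
by move/eqP.
Qed.

Lemma nonzero_triple_compl F G : nonzero_triple (comp_triple F G) -> nonzero_triple F.
Proof.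
by move=> [k]; rewrite tnth_mktuple => FGk; exists k; apply: contra_neq FGk => ->; exact: comp_mpoly0.
Qed.

Record birrep := BirRep {
  fwd : triple;
  bwd : triple;
  fwd_homog : exists d, homogeneous_triple d fwd;
  bwd_homog : exists d, homogeneous_triple d bwd;
  fwdK : inverse_triples bwd fwd;
  bwdK : inverse_triples fwd bwd }.

HB.instance Definition _ := gen_eqMixin birrep.
HB.instance Definition _ := gen_choiceMixin birrep.

Lemma fwd_neq0 (f : birrep) : nonzero_triple (fwd f).
Proof. by have [/nonzero_triple_compl] := bwdK f. Qed.

Lemma inverse_triples_comp (f g : birrep) :
  inverse_triples (comp_triple (fwd f) (fwd g)) (comp_triple (bwd g) (bwd f)).
Proof.
have [d hf] := fwd_homog f; have [e hg] := fwd_homog g.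
have nfg := nonzero_comp hf (fwd_neq0 f) (bwdK g).
have nfgg := nonzero_comp (homogeneous_comp hf hg) nfg (fwdK g).
have [e' hg'] := bwd_homog g.
have nfggf := nonzero_comp (homogeneous_comp (homogeneous_comp hf hg) hg') nfgg (fwdK f).
split; first by rewrite comp_tripleA.
rewrite -comp_tripleA; apply: (@proportional_trans (comp_triple (fwd f) (bwd f))).
- by have [] := bwdK f.
- apply: (proportional_compr hf).
    by have [/nonzero_triple_compl] := fwdK f.
  rewrite comp_tripleA -[X in proportional _ X]comp_triple1l.
  by apply: proportional_compl; have [] := bwdK g.
- by have [] := bwdK f.
Qed.

Definition birrep_inv (f : birrep) : birrep :=
  BirRep (bwd_homog f) (fwd_homog f) (bwdK f) (fwdK f).

Lemma homogeneous_comp_ex F G : (exists d, homogeneous_triple d F) ->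
  (exists d, homogeneous_triple d G) -> exists d, homogeneous_triple d (comp_triple F G).
Proof. by move=> [d hF] [e hG]; exists (d * e)%N; exact: homogeneous_comp. Qed.

Definition birrep_comp (f g : birrep) : birrep :=
  BirRep (homogeneous_comp_ex (fwd_homog f) (fwd_homog g))
         (homogeneous_comp_ex (bwd_homog g) (bwd_homog f))
         (inverse_triples_comp (birrep_inv g) (birrep_inv f))
         (inverse_triples_comp f g).

Lemma inverse_id : inverse_triples id_triple id_triple.
Proof. by rewrite /inverse_triples comp_triple1; split; [exact: nonzero_id|exact: proportional_refl]. Qed.

Definition birrep_id : birrep :=
  BirRep (ex_intro (homogeneous_triple^~ id_triple) 1%N homogeneous_id)
    (ex_intro (homogeneous_triple^~ id_triple) 1%N homogeneous_id)
    inverse_id inverse_id.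

Definition birrep_eq (f g : birrep) : bool := `[< proportional (fwd f) (fwd g) >].

Lemma birrep_eq_refl : reflexive birrep_eq.
Proof. by move=> f; apply/asboolP; exact: proportional_refl. Qed.

Lemma birrep_eq_sym : ssrbool.symmetric birrep_eq.
Proof. by move=> f g; apply/asboolP/asboolP; exact: proportional_sym. Qed.

Lemma birrep_eq_trans : transitive birrep_eq.
Proof.
move=> g f h /asboolP fg /asboolP gh; apply/asboolP.
exact: proportional_trans (fwd_neq0 g) fg gh.
Qed.

Canonical birrep_equiv := EquivRel birrep_eq birrep_eq_refl birrep_eq_sym birrep_eq_trans.

Definition Bir := {eq_quot birrep_equiv}.
HB.instance Definition _ := Choice.on Bir.
HB.instance Definition _ := EqQuotient.on Bir.

Lemma bir_eqP (f g : birrep) : \pi_Bir f = \pi_Bir g <-> proportional (fwd f) (fwd g).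
Proof. by split=> [/eqmodP/asboolP|h]; [|apply/eqmodP/asboolP]. Qed.

Lemma bir_reprP (f : birrep) : proportional (fwd (repr (\pi_Bir f))) (fwd f).
Proof. by apply/bir_eqP; rewrite reprK. Qed.

Definition bir_one : Bir := \pi_Bir birrep_id.
Definition bir_mul (f g : Bir) : Bir := \pi_Bir (birrep_comp (repr f) (repr g)).
Definition bir_inv (f : Bir) : Bir := \pi_Bir (birrep_inv (repr f)).

Lemma pi_birrep_comp f g : \pi_Bir (birrep_comp f g) = bir_mul (\pi_Bir f) (\pi_Bir g).
Proof.
apply/bir_eqP => /=; apply: (@proportional_trans (comp_triple (fwd f) (fwd (repr (\pi_Bir g))))).
- by have [d h] := fwd_homog f; exact: nonzero_comp h (fwd_neq0 f) (bwdK _).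
- have [d h] := fwd_homog f; apply: (proportional_compr h (fwd_neq0 _)).
  exact/proportional_sym/bir_reprP.
- exact/proportional_compl/proportional_sym/bir_reprP.
Qed.

Lemma bir_mulA : associative bir_mul.
Proof.
elim/quotW=> f; elim/quotW=> g; elim/quotW=> h.
rewrite -(pi_birrep_comp g h) -(pi_birrep_comp f g) -!pi_birrep_comp.
by apply/bir_eqP; rewrite /= comp_tripleA; exact: proportional_refl.
Qed.

Lemma bir_mul1 : left_id bir_one bir_mul.
Proof.
elim/quotW=> f; rewrite -pi_birrep_comp.
by apply/bir_eqP; rewrite /= comp_triple1l; exact: proportional_refl.
Qed.

Lemma bir_1mul : right_id bir_one bir_mul.
Proof.
elim/quotW=> f; rewrite -pi_birrep_comp.
by apply/bir_eqP; rewrite /= comp_triple1; exact: proportional_refl.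
Qed.

Lemma bir_mulV : left_inverse bir_one bir_inv bir_mul.
Proof.
move=> f; rewrite -[f in X in bir_mul _ X]reprK -pi_birrep_comp.
by apply/bir_eqP; have [] := fwdK (repr f).
Qed.

Lemma bir_Vmul : right_inverse bir_one bir_inv bir_mul.
Proof.
move=> f; rewrite -[f in X in bir_mul X _]reprK -pi_birrep_comp.
by apply/bir_eqP; have [] := bwdK (repr f).
Qed.

HB.instance Definition _ := isGroup.Build Bir bir_mulA bir_mul1 bir_1mul bir_mulV bir_Vmul.

End Triples.

Section BirGroup.
Context (K : fieldType).

(* Proportionality is transitive on nonzero triples, so this does not depend on
   the chosen representative of f. *)
Definition represents (F : triple K) (f : Bir K) :=
  [/\ exists d, homogeneous_triple d F, nonzero_triple F &
      proportional F (fwd (repr f))].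

Definition coprime_triple (F : triple K) :=
  forall h (G : triple K), (forall i, tnth F i = h * tnth G i) -> exists c, h = c%:MP.

(* The degree of [F_0 : F_1 : F_2] is read off a triple without common factor. *)
Definition has_degree (f : Bir K) (d : nat) :=
  exists F, [/\ represents F f, homogeneous_triple d F & coprime_triple F].

Definition bounded_degree (S : set (Bir K)) :=
  exists D : nat, forall f, S f -> exists2 d, (d <= D)%N & has_degree f d.

(* The function field C(x,y) is taken as C(y)(x). *)
Local Notation Ky := {fraction {poly K}}.
Local Notation Kxy := {fraction {poly Ky}}.
Local Notation "x %:F" := (@FracField.tofrac _ x).

Definition Ky_in (a : Ky) : Kxy := a%:P%:F.
Definition K_in (c : K) : Kxy := Ky_in c%:P%:F.
HB.instance Definition _ := GRing.RMorphism.copy Ky_in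
  (@FracField.tofrac {poly Ky} \o @polyC Ky).
HB.instance Definition _ := GRing.RMorphism.copy K_in
  (Ky_in \o (@FracField.tofrac {poly K} \o @polyC K)).

Definition xvar : Kxy := 'X%:F.
Definition yvar : Kxy := Ky_in 'X%:F.

Definition dehomogenize (p : {mpoly K[3]}) : Kxy :=
  mmap K_in (tnth [tuple xvar; yvar; 1]) p.

(* The coordinates of f on the chart (x,y) |-> [x : y : 1].  No denominator
   vanishes, as the image of a birational map is not inside the line z = 0. *)
Definition affine_form (f : Bir K) : Kxy * Kxy :=
  let F i := dehomogenize (tnth (fwd (repr f)) i) in (F 0 / F 2, F 1 / F 2).

(* Classes in PGL_2 are given by representatives in GL_2. *)
Definition Jonq : set (Bir K) :=
  [set f | exists (M : 'M[Ky]_2) (N : 'M[K]_2), [/\ M \in unitmx, N \in unitmx &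
     affine_form f =
       ((Ky_in (M 0 0) * xvar + Ky_in (M 0 1)) / (Ky_in (M 1 0) * xvar + Ky_in (M 1 1)),
        (K_in (N 0 0) * yvar + K_in (N 0 1)) / (K_in (N 1 0) * yvar + K_in (N 1 1)))]].

Definition U1 : set (Bir K) := [set f | exists c, affine_form f = (xvar + K_in c, yvar)].
Definition U2 : set (Bir K) := [set f | exists c, affine_form f = (xvar, yvar + K_in c)].

End BirGroup.

Section Spaces.
Context (K : closedFieldType).

(* Varieties are spaces with functions: a topological space with, on each open
   set U, a sheaf of algebras of K-valued functions.  Functions are total, and
   regular U f only concerns the restriction of f to the open set U; regular is
   unconstrained when U is not open. *)
Record funspace := FunSpace {
  space_sort :> topologicalType;
  regular : set space_sort -> (space_sort -> K) -> Prop;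
  regular_restrict : forall U W f, open U -> open W -> W `<=` U ->
    regular U f -> regular W f;
  regular_glue : forall U f, open U ->
    (forall p, U p -> exists W g, [/\ open W, W p, W `<=` U, regular W g &
                                     forall q, W q -> f q = g q]) ->
    regular U f;
  regular_cst : forall U (c : K), open U -> regular U (fun=> c);
  regular_add : forall U f g, open U -> regular U f -> regular U g ->
    regular U (fun p => f p + g p);
  regular_mul : forall U f g, open U -> regular U f -> regular U g ->
    regular U (fun p => f p * g p) }.

(* frac B h k says that h and k may serve as numerator and denominator on B.
   In the space they generate, the sets B minus the zeros of k form a basis of
   the topology, and the regular functions are those locally equal to some
   h / k. *)
Record fractions (T : Type) := Fractions {
  frac : set T -> (T -> K) -> (T -> K) -> Prop;
  frac_cst : forall c, frac setT (fun=> c) (fun=> 1);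
  frac_den : forall B h k, frac B h k -> frac B k k;
  frac_add : forall B h k B' h' k', frac B h k -> frac B' h' k' ->
    frac (B `&` B') (fun p => h p * k' p + h' p * k p) (fun p => k p * k' p);
  frac_mul : forall B h k B' h' k', frac B h k -> frac B' h' k' ->
    frac (B `&` B') (fun p => h p * h' p) (fun p => k p * k' p) }.

Definition frac_carrier (T : Type) (F : fractions T) : Type := T.

Section FracSpace.
Context (T : Type) (F : fractions T).
Implicit Types (U W : set (frac_carrier F)) (f g : frac_carrier F -> K).

Definition frac_open : set (set (frac_carrier F)) := [set U | forall p, U p ->
  exists B h k, [/\ frac F B h k, B p, k p != 0 & forall q, B q -> k q != 0 -> U q]].

Definition frac_regular (U : set (frac_carrier F)) (f : frac_carrier F -> K) :=
  forall p, U p -> exists B h k, [/\ frac F B h k, B p, k p != 0 &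
    forall q, U q -> B q -> k q != 0 -> f q = h q / k q].

Fact frac_openT : frac_open setT.
Proof.
move=> p _; exists setT, (fun=> 1), (fun=> 1).
by split=> //; [exact: frac_cst|exact: oner_neq0].
Qed.

Fact frac_openI : setI_closed frac_open.
Proof.
move=> U W oU oW p [/oU [B [h [k [F1 Bp kp BU]]]] /oW [B' [h' [k' [F2 Bp' kp' BW]]]]].
exists (B `&` B'), (fun p => h p * h' p), (fun p => k p * k' p).
split=> //; [exact: frac_mul|by rewrite mulf_neq0|].
move=> q [Bq B'q]; rewrite mulf_eq0 negb_or => /andP[kq k'q].
by split; [exact: BU|exact: BW].
Qed.

Fact frac_open_bigU (I : Type) (f : I -> set (frac_carrier F)) :
  (forall i, frac_open (f i)) -> frac_open (\bigcup_i f i).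
Proof.
move=> of_ p [i _ /of_ [B [h [k [F1 Bp kp BU]]]]]; exists B, h, k; split=> // q Bq kq.
by exists i => //; exact: BU.
Qed.

HB.instance Definition _ := gen_eqMixin (frac_carrier F).
HB.instance Definition _ := gen_choiceMixin (frac_carrier F).
HB.instance Definition _ := isOpenTopological.Build (frac_carrier F)
  frac_openT frac_openI frac_open_bigU.

Fact frac_regular_restrict (U W : set (frac_carrier F)) f : open U -> open W -> W `<=` U ->
  frac_regular U f -> frac_regular W f.
Proof.
move=> _ _ WU rf p /WU /rf [B [h [k [F1 Bp kp E]]]]; exists B, h, k; split=> // q /WU.
exact: E.
Qed.

Fact frac_regular_glue (U : set (frac_carrier F)) f : open U ->
  (forall p, U p -> exists W g, [/\ open W, W p, W `<=` U, frac_regular W g &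
                                   forall q, W q -> f q = g q]) ->
  frac_regular U f.
Proof.
move=> _ loc p /loc [W [g [oW Wp WU rg fg]]].
have [B [h [k [F1 Bp kp gE]]]] := rg p Wp.
have [B' [h' [k' [F2 B'p k'p B'W]]]] := (oW : frac_open W) p Wp.
exists (B `&` B'), (fun p => h p * k' p), (fun p => k p * k' p); split=> //.
- exact/frac_mul/(frac_den F2).
- by rewrite mulf_neq0.
- move=> q Uq [Bq B'q]; rewrite mulf_eq0 negb_or => /andP[kq k'q].
  have Wq : W q by exact: B'W.
  by rewrite fg // gE // -mulf_div divff // mulr1.
Qed.

Fact frac_regular_cst (U : set (frac_carrier F)) (c : K) : open U -> frac_regular U (fun=> c).
Proof.
move=> _ p _; exists setT, (fun=> c), (fun=> 1).
by split=> //; [exact: frac_cst|exact: oner_neq0|move=> *; rewrite divr1].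
Qed.

Fact frac_regular_add (U : set (frac_carrier F)) f g : open U ->
  frac_regular U f -> frac_regular U g -> frac_regular U (fun p => f p + g p).
Proof.
move=> _ rf rg p Up.
have [B [h [k [F1 Bp kp fE]]]] := rf p Up.
have [B' [h' [k' [F2 B'p k'p gE]]]] := rg p Up.
exists (B `&` B'), (fun p => h p * k' p + h' p * k p), (fun p => k p * k' p); split=> //.
- exact: frac_add.
- by rewrite mulf_neq0.
- move=> q Uq [Bq B'q]; rewrite mulf_eq0 negb_or => /andP[kq k'q].
  by rewrite fE // gE // addf_div.
Qed.

Fact frac_regular_mul (U : set (frac_carrier F)) f g : open U ->
  frac_regular U f -> frac_regular U g -> frac_regular U (fun p => f p * g p).
Proof.
move=> _ rf rg p Up.
have [B [h [k [F1 Bp kp fE]]]] := rf p Up.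
have [B' [h' [k' [F2 B'p k'p gE]]]] := rg p Up.
exists (B `&` B'), (fun p => h p * h' p), (fun p => k p * k' p); split=> //.
- exact: frac_mul.
- by rewrite mulf_neq0.
- move=> q Uq [Bq B'q]; rewrite mulf_eq0 negb_or => /andP[kq k'q].
  by rewrite fE // gE // mulf_div.
Qed.

Definition frac_space : funspace :=
  FunSpace frac_regular_restrict frac_regular_glue frac_regular_cst
        frac_regular_add frac_regular_mul.

Lemma frac_openE (U : set frac_space) : open U = frac_open U.
Proof. by []. Qed.

End FracSpace.

Section Affine.
Context (n : nat).

Inductive affine_frac : set 'rV[K]_n -> ('rV[K]_n -> K) -> ('rV[K]_n -> K) -> Prop :=
  AffineFrac (P Q : {mpoly K[n]}) :
    affine_frac setT (fun p => P.@[p 0]) (fun p => Q.@[p 0]).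

Lemma affine_frac_ext (P Q : {mpoly K[n]}) B (h k : 'rV[K]_n -> K) : B = setT ->
  (forall p, h p = P.@[p 0]) -> (forall p, k p = Q.@[p 0]) -> affine_frac B h k.
Proof. by move=> -> /funext -> /funext ->. Qed.

Fact affine_frac_cst c : affine_frac setT (fun=> c) (fun=> 1).
Proof. by apply: (@affine_frac_ext c%:MP 1) => // p; rewrite ?mevalC ?meval1. Qed.

Fact affine_frac_den B h k : affine_frac B h k -> affine_frac B k k.
Proof. by case. Qed.

Fact affine_frac_add B h k B' h' k' : affine_frac B h k -> affine_frac B' h' k' ->
  affine_frac (B `&` B') (fun p => h p * k' p + h' p * k p) (fun p => k p * k' p).
Proof.
move=> [P Q] [P' Q'].
by apply: (@affine_frac_ext (P * Q' + P' * Q) (Q * Q')) => [|p|p];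
  rewrite ?setIT ?mevalD ?mevalM.
Qed.

Fact affine_frac_mul B h k B' h' k' : affine_frac B h k -> affine_frac B' h' k' ->
  affine_frac (B `&` B') (fun p => h p * h' p) (fun p => k p * k' p).
Proof.
move=> [P Q] [P' Q'].
by apply: (@affine_frac_ext (P * P') (Q * Q')) => [|p|p]; rewrite ?setIT ?mevalM.
Qed.

Definition affine_fractions :=
  Fractions affine_frac_cst affine_frac_den affine_frac_add affine_frac_mul.

Definition affine : funspace := frac_space affine_fractions.
End Affine.

Section Projective.
Context (n : nat).

(* A point of P^n is a line of K^(n+1). *)
Record proj_point := ProjPoint { line : {vspace 'rV[K]_n.+1}; _ : \dim line = 1%N }.

(* Homogeneous coordinates, from some nonzero vector of the line; they are only
   used in ways that do not depend on this choice. *)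
Definition hcoord (p : proj_point) : 'I_n.+1 -> K := vpick (line p) 0.

Inductive proj_frac : set proj_point -> (proj_point -> K) -> (proj_point -> K) -> Prop :=
  ProjFrac d (P Q : {mpoly K[n.+1]}) of P \is d.-homog & Q \is d.-homog :
    proj_frac setT (fun p => P.@[hcoord p]) (fun p => Q.@[hcoord p]).

Lemma proj_frac_ext d (P Q : {mpoly K[n.+1]}) B h k : P \is d.-homog -> Q \is d.-homog ->
  B = setT ->
  (forall p, h p = P.@[hcoord p]) -> (forall p, k p = Q.@[hcoord p]) -> proj_frac B h k.
Proof. by move=> hP hQ -> /funext -> /funext ->; exact: (ProjFrac hP hQ). Qed.

Fact proj_frac_cst c : proj_frac setT (fun=> c) (fun=> 1).
Proof.
apply: (@proj_frac_ext 0%N c%:MP 1) => [|||p|p]; rewrite ?mevalC ?meval1 //.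
  by rewrite -[c%:MP]mulr1 mul_mpolyC; apply/dhomogZ/dhomog1.
exact: dhomog1.
Qed.

Fact proj_frac_den B h k : proj_frac B h k -> proj_frac B k k.
Proof. by case=> d P Q hP hQ; exact: (ProjFrac hQ hQ). Qed.

Fact proj_frac_add B h k B' h' k' : proj_frac B h k -> proj_frac B' h' k' ->
  proj_frac (B `&` B') (fun p => h p * k' p + h' p * k p) (fun p => k p * k' p).
Proof.
move=> [d P Q hP hQ] [d' P' Q' hP' hQ'].
apply: (@proj_frac_ext (d + d') (P * Q' + P' * Q) (Q * Q')) => [|||p|p];
  rewrite ?setIT ?mevalD ?mevalM //; last exact: dhomogM.
by apply: dhomogD; [|rewrite addnC]; exact: dhomogM.
Qed.

Fact proj_frac_mul B h k B' h' k' : proj_frac B h k -> proj_frac B' h' k' ->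
  proj_frac (B `&` B') (fun p => h p * h' p) (fun p => k p * k' p).
Proof.
move=> [d P Q hP hQ] [d' P' Q' hP' hQ'].
by apply: (@proj_frac_ext (d + d') (P * P') (Q * Q')) => [|||p|p];
  rewrite ?setIT ?mevalM //; exact: dhomogM.
Qed.

Definition proj_fractions :=
  Fractions proj_frac_cst proj_frac_den proj_frac_add proj_frac_mul.

Definition proj : funspace := frac_space proj_fractions.
End Projective.

Section Product.
Context (X Y : funspace).

(* The functions sum_i f_i(x) g_i(y): X * Y has the product structure of
   algebraic geometry, not the product topology. *)
Definition tensor (U : set X) (V : set Y) (h : X * Y -> K) :=
  exists (I : finType) (f : I -> X -> K) (g : I -> Y -> K),
    [/\ forall i, regular U (f i), forall i, regular V (g i) &
        forall p, h p = \sum_i f i p.1 * g i p.2].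

Inductive prod_frac : set (X * Y) -> (X * Y -> K) -> (X * Y -> K) -> Prop :=
  ProdFrac (U : set X) (V : set Y) h k of open U & open V & tensor U V h & tensor U V k :
    prod_frac (U `*` V) h k.

Lemma tensor_cst (U : set X) (V : set Y) c : open U -> open V -> tensor U V (fun=> c).
Proof.
move=> oU oV; exists unit, (fun _ _ => c), (fun _ _ => 1); split=> *.
- exact: regular_cst.
- exact: regular_cst.
- by rewrite big_const card_unit /= addr0 mulr1.
Qed.

Lemma tensor_restrict (U U' : set X) (V V' : set Y) h :
  open U -> open V -> open U' -> open V' -> tensor U V h -> tensor (U `&` U') (V `&` V') h.
Proof.
move=> oU oV oU' oV' [I [f [g [rf rg E]]]]; exists I, f, g; split=> // j.
  by apply: (regular_restrict oU _ _ (rf j)); [exact: openI|exact: subIsetl].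
by apply: (regular_restrict oV _ _ (rg j)); [exact: openI|exact: subIsetl].
Qed.

Lemma tensor_add (U : set X) (V : set Y) h h' :
  tensor U V h -> tensor U V h' -> tensor U V (fun p => h p + h' p).
Proof.
move=> [I [f [g [rf rg E]]]] [I' [f' [g' [rf' rg' E']]]].
exists (I + I')%type, (fun s => match s with inl j => f j | inr j => f' j end),
  (fun s => match s with inl j => g j | inr j => g' j end); split=> [[]//|[]//|p].
by rewrite big_sumType /= E E'.
Qed.

Lemma tensor_mul (U : set X) (V : set Y) h h' : open U -> open V ->
  tensor U V h -> tensor U V h' -> tensor U V (fun p => h p * h' p).
Proof.
move=> oU oV [I [f [g [rf rg E]]]] [I' [f' [g' [rf' rg' E']]]].
exists (I * I')%type, (fun s x => f s.1 x * f' s.2 x), (fun s y => g s.1 y * g' s.2 y).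
split=> [s|s|p]; [exact: regular_mul|exact: regular_mul|].
rewrite E E' big_distrlr /= pair_big /=; apply: eq_bigr => s _.
by rewrite mulrACA.
Qed.

Fact prod_frac_cst c : prod_frac setT (fun=> c) (fun=> 1).
Proof. by rewrite -setXTT; apply: ProdFrac; do ?[exact: openT|apply: tensor_cst]. Qed.

Fact prod_frac_den B h k : prod_frac B h k -> prod_frac B k k.
Proof. by case=> *; exact: ProdFrac. Qed.

Fact prod_frac_add B h k B' h' k' : prod_frac B h k -> prod_frac B' h' k' ->
  prod_frac (B `&` B') (fun p => h p * k' p + h' p * k p) (fun p => k p * k' p).
Proof.
move=> [U V {}h {}k oU oV th tk] [U' V' {}h' {}k' oU' oV' th' tk'].
have restr h0 : tensor U V h0 -> tensor (U `&` U') (V `&` V') h0.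
  exact: tensor_restrict.
have restr' h0 : tensor U' V' h0 -> tensor (U `&` U') (V `&` V') h0.
  by rewrite setIC [V `&` _]setIC; exact: tensor_restrict.
rewrite -setXI; apply: ProdFrac; do ?exact: openI.
  apply: tensor_add; apply: tensor_mul; try exact: openI.
  - exact: restr.
  - exact: restr'.
  - exact: restr'.
  - exact: restr.
by apply: tensor_mul; [exact: openI|exact: openI|exact: restr|exact: restr'].
Qed.

Fact prod_frac_mul B h k B' h' k' : prod_frac B h k -> prod_frac B' h' k' ->
  prod_frac (B `&` B') (fun p => h p * h' p) (fun p => k p * k' p).
Proof.
move=> [U V {}h {}k oU oV th tk] [U' V' {}h' {}k' oU' oV' th' tk'].
have restr h0 : tensor U V h0 -> tensor (U `&` U') (V `&` V') h0.
  exact: tensor_restrict.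
have restr' h0 : tensor U' V' h0 -> tensor (U `&` U') (V `&` V') h0.
  by rewrite setIC [V `&` _]setIC; exact: tensor_restrict.
by rewrite -setXI; apply: ProdFrac; try exact: openI;
  (apply: tensor_mul; [exact: openI|exact: openI|exact: restr|exact: restr']).
Qed.

Definition prod_fractions :=
  Fractions prod_frac_cst prod_frac_den prod_frac_add prod_frac_mul.

Definition prod_space : funspace := frac_space prod_fractions.
End Product.


Definition morphism_on (X Y : funspace) (U : set X) (f : X -> Y) :=
  forall W : set Y, open W -> open (U `&` f @^-1` W) /\
    forall g, regular W g -> regular (U `&` f @^-1` W) (g \o f).

Definition morphism (X Y : funspace) (f : X -> Y) := morphism_on setT f.

Definition isomorphism_on (X Y : funspace) (U : set X) (V : set Y)
    (f : X -> Y) (g : Y -> X) :=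
  [/\ open U, open V, morphism_on U f, morphism_on V g &
      (forall p, U p -> V (f p) /\ g (f p) = p) /\
      (forall q, V q -> U (g q) /\ f (g q) = q)].

(* phi identifies U, as a space with functions, with phi(U) carrying the
   structure induced from Y.  With U open, Y affine and phi(U) closed, U is an
   affine variety. *)
Definition immersion_on (X Y : funspace) (U : set X) (phi : X -> Y) :=
  [/\ set_inj U phi,
      forall W, W `<=` U ->
        (open W <-> exists O, open O /\ W = U `&` phi @^-1` O) &
      forall W f, open W -> W `<=` U ->
        (regular W f <-> forall p, W p -> exists O g,
           [/\ open O, O (phi p), regular O g &
               forall q, W q -> O (phi q) -> f q = g (phi q)])].

Definition affine_open (X : funspace) (U : set X) :=
  open U /\ exists n (phi : X -> affine n),
    immersion_on U phi /\ closed (phi @` U).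

(* A space with a finite affine open cover and a closed diagonal. *)
Definition variety (X : funspace) :=
  (exists m (U : 'I_m -> set X),
     (forall i, affine_open (U i)) /\ \bigcup_i U i = setT) /\
  closed ([set p | p.1 = p.2] : set (prod_space X X)).

Definition irreducible (X : funspace) := @setT X !=set0 /\
  forall F G : set X, closed F -> closed G -> F `|` G = setT ->
    F = setT \/ G = setT.

Definition triple_at (F : triple K) (w : proj 2) : 'rV[K]_3 :=
  \row_i (tnth F i).@[hcoord w].

(* f is an isomorphism U -> V over A, where U is dense as soon as A is
   irreducible.  The last clause says that phi a is the birational map
   w |-> p_2 (f (a, w)). *)
Definition bir_morphism (A : funspace) (phi : A -> Bir K) :=
  exists (U V : set (prod_space A (proj 2)))
         (f g : prod_space A (proj 2) -> prod_space A (proj 2)),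
    [/\ isomorphism_on U V f g,
        forall p, U p -> (f p).1 = p.1,
        [set p.1 | p in U] = setT,
        [set p.1 | p in V] = setT &
        forall a w F, U (a, w) -> represents F (phi a) -> triple_at F w != 0 ->
          line (f (a, w)).2 = <[triple_at F w]>%VS].

(* The Zariski topology of Bir(P^2). *)
Definition bir_closed (S : set (Bir K)) :=
  forall (A : funspace) (phi : A -> Bir K), variety A -> irreducible A ->
    bir_morphism phi -> closed (phi @^-1` S).

Definition algebraic_subgroup (G : set (Bir K)) :=
  [/\ group_closed (mem G), bir_closed G & bounded_degree G].

(* X, with the group law of G transported along the bijection pi, is G with its
   natural structure of algebraic group: its topology is the one induced from
   Bir(P^2), and a morphism from an irreducible variety to X is a morphism to
   Bir(P^2) with values in G. *)
Record natural_structure (G : set (Bir K)) (X : funspace) (pi : X -> Bir K) : Prop := {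
  ns_variety : variety X;
  ns_bij : set_bij setT G pi;
  ns_mul : exists2 m : prod_space X X -> X, morphism m &
    forall x y, pi (m (x, y)) = (pi x * pi y)%g;
  ns_inv : exists2 i : X -> X, morphism i & forall x, pi (i x) = (pi x)^-1%g;
  ns_closed : forall F : set X, closed F <-> bir_closed (pi @` F);
  ns_morphism : forall (A : funspace) (phi : A -> X), variety A -> irreducible A ->
    (morphism phi <-> bir_morphism (pi \o phi)) }.

Definition isomorphic_to_Ga (G : set (Bir K)) :=
  exists (X : funspace) (pi : X -> Bir K), natural_structure G pi /\
    exists (psi : X -> affine 1) (theta : affine 1 -> X),
      isomorphism_on setT setT psi theta /\
      forall s t : 'rV[K]_1, pi (theta (s + t)) = (pi (theta s) * pi (theta t))%g.

End Spaces.

(* Main.v *)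
(* Idea. A birational map f acts on the function field C(x,y) by the pullback f^*,
   computed on quotients P/Q of forms of the same degree as (P o f)/(Q o f).  If
   (f_t) is the flow of G and sigma_t = f_t^*, then sigma_t x = M_t x and
   sigma_t y = N_t y are Moebius transforms, and it suffices to find a Jonquieres
   pair of coordinates (xi, eta) = (M x, N y) with sigma_t (xi, eta) equal to
   (xi + t, eta) or (xi, eta + t): the element of Bir with pullback
   (x, y) |-> (xi, eta) conjugates G to U1 or U2.
   As G carries its natural structure, sigma_t x and sigma_t y are rational in t,
   hence so are M_t and N_t up to scalars (interpolation at three points).
   A one-parameter subgroup M_t of PGL_2(F), rational in t, is conjugate to
   X |-> X + b t: the limit of M_t u for t -> oo is a common fixed point, placed at
   infinity; then M_t = a_t X + b_t with a_{s+t} = a_s a_t, comparing leading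
   coefficients gives a_s = 1, and b_t is additive and rational, hence linear.
   Applied to N over C this gives eta = S y with sigma_t eta = eta + b t.
   - If b = 0, sigma_t fixes C(y) and the same applied to M over C(y) gives xi.
   - If b <> 0, normalise b = 1; the function xi = M_{u - eta} x, for a general
     constant u, is the x-coordinate of the point where the orbit meets the fibre
     eta = u, and so it is invariant. *)
From HB Require Import structures.
Require Import Defs.
From mathcomp Require Import all_boot all_order all_algebra.
From mathcomp Require Import boolp classical_sets functions reals topology_structure.
From mathcomp Require Import complex.
From mathcomp Require Import generic_quotient mpoly.
From mathcomp Require Import ring.

Set Implicit Arguments.
Unset Strict Implicit.
Unset Printing Implicit Defensive.

Import Order.TTheory GRing.Theory Num.Theory.
Local Open Scope classical_set_scope.
Local Open Scope quotient_scope.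
Local Open Scope ring_scope.

(** * Elements of a fraction field as quotients *)

Section Fractions.
Context (R : idomainType).
Local Notation "x %:F" := (@FracField.tofrac R x).

Lemma fractionP (z : {fraction R}) : exists p q, q != 0 /\ z = p%:F / q%:F.
Proof.
elim/quotW: z => x; exists \n_x, \d_x; split; first exact: denom_ratioP.
have d0 : (\d_x)%:F != 0 by rewrite tofrac_eq0 denom_ratioP.
apply: (mulIf d0); rewrite divfK //.
unlock FracField.tofrac.
rewrite -[LHS]FracField.pi_mul; apply/eqmodP; rewrite /= FracField.equivfE.
by rewrite /FracField.mulf !numden_Ratio ?oner_eq0 ?mulr1 ?mulf_neq0 ?denom_ratioP // mulrC.
Qed.

End Fractions.

(** * Forms on the plane read in the chart z = 1 *)

Section FunctionField.
Context (K : fieldType).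
Local Notation Ky := {fraction {poly K}}.
Local Notation Kxy := {fraction {poly Ky}}.
Local Notation "x %:F" := (@FracField.tofrac _ x).

Definition poly_in (p : {poly {poly K}}) : Kxy := (map_poly (@FracField.tofrac {poly K}) p)%:F.

Fact poly_in_is_zmod_morphism : zmod_morphism poly_in.
Proof. by move=> p q; rewrite /poly_in !rmorphB. Qed.

Fact poly_in_is_monoid_morphism : monoid_morphism poly_in.
Proof. by split=> [|p q]; rewrite /poly_in ?rmorph1 // !rmorphM. Qed.

HB.instance Definition _ := GRing.isZmodMorphism.Build {poly {poly K}} Kxy poly_in
  poly_in_is_zmod_morphism.
HB.instance Definition _ := GRing.isMonoidMorphism.Build {poly {poly K}} Kxy poly_in
  poly_in_is_monoid_morphism.

Lemma poly_inX : poly_in 'X = xvar K.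
Proof. by rewrite /poly_in map_polyX. Qed.

Lemma poly_inC (p : {poly K}) : poly_in p%:P = Ky_in p%:F.
Proof. by rewrite /poly_in map_polyC. Qed.

Definition cst2 (c : K) : {poly {poly K}} := c%:P%:P.

Fact cst2_is_zmod_morphism : zmod_morphism cst2.
Proof. by move=> p q; rewrite /cst2 !polyCB. Qed.

Fact cst2_is_monoid_morphism : monoid_morphism cst2.
Proof. by split=> [|p q]; rewrite /cst2 // !polyCM. Qed.

HB.instance Definition _ := GRing.isZmodMorphism.Build K {poly {poly K}} cst2
  cst2_is_zmod_morphism.
HB.instance Definition _ := GRing.isMonoidMorphism.Build K {poly {poly K}} cst2
  cst2_is_monoid_morphism.

(** Takes values in K[y][x] and not in the function field, so that the result can also be evaluated
    at points of the chart; [poly_in] leads back to [dehomogenize]. *)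
Definition chart : {mpoly K[3]} -> {poly {poly K}} :=
  mmap cst2 (tnth [tuple 'X; 'X%:P; 1]).
HB.instance Definition _ := GRing.RMorphism.copy chart
  (mmap cst2 (tnth [tuple 'X; 'X%:P; 1])).

Lemma poly_in_chart p : poly_in (chart p) = dehomogenize p.
Proof.
rewrite /chart /dehomogenize /mmap rmorph_sum; apply: eq_bigr => m _ /=.
rewrite rmorphM; congr (_ * _); first exact: poly_inC.
rewrite /mmap1 rmorph_prod; apply: eq_bigr => i _; rewrite rmorphXn; congr (_ ^+ _).
by case: i => [[|[|[|]]]] //= ?; rewrite !(tnth_nth 0) //= ?poly_inX ?poly_inC ?rmorph1.
Qed.

(** In a form of degree [d] the exponents of x and y determine that of z, so distinct monomials stay
    distinct on the chart. *)
Lemma chart_inj d p : p \is d.-homog -> chart p = 0 -> p = 0.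
Proof.
move=> hp p0; apply/eqP; rewrite -msupp_eq0; apply/eqP.
case E: (msupp p) => [//|m s].
have mp : m \in msupp p by rewrite E inE eqxx.
have := congr1 (fun q : {poly {poly K}} => q`_(m ord0)`_(m (inord 1))) p0.
rewrite /chart /mmap coef_sum coef_sum (bigD1_seq m) //= ?msupp_uniq //.
have cE m' : (cst2 p@_m' * mmap1 (tnth [tuple 'X; 'X%:P; 1]) m')`_(m ord0)`_(m (inord 1))
   = p@_m' *+ (m' ord0 == m ord0) *+ (m' (inord 1) == m (inord 1)).
  rewrite /mmap1 !big_ord_recl big_ord0 mulr1 !(tnth_nth 0) /= expr1n mulr1.
  have -> : lift ord0 ord0 = inord 1 :> 'I_3 by apply/val_inj; rewrite /= inordK.
  rewrite -polyC_exp coefCM coefMC coefXn coefCM [in RHS]eq_sym [_ == m (inord 1)]eq_sym.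
  by case: (_ == _); rewrite ?mul1r ?coefXn ?mul0r ?coef0 ?mulr0 ?mulr1n ?mulr0n ?mul0rn // mulr_natr.
rewrite cE !eqxx !mulr1n big_seq_cond big1 ?addr0; last first.
  move=> m' /andP[m'p nm]; rewrite cE.
  case: eqP => [e0|]; last by rewrite mulr0n mul0rn.
  case: eqP => [e1|]; last by rewrite mulr0n.
  case/eqP: nm; apply/mnmP.
  have := dhomog_mf hp m'p; rewrite -(dhomog_mf hp mp) /= !mdegE !big_ord_recl !big_ord0.
  have -> : lift ord0 ord0 = inord 1 :> 'I_3 by apply/val_inj; rewrite /= inordK.
  rewrite e0 e1 !addn0 => /addnI /addnI e2 i.
  have [->|->|->] : [\/ i = ord0, i = inord 1 | i = lift ord0 (lift ord0 ord0)] => //.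
  case: i => [[|[|[|]]]] //= ?; [apply: Or31|apply: Or32|apply: Or33]; apply/val_inj => //=.
  by rewrite inordK.
move/eqP; rewrite coef0 coef0 => /eqP pm0.
by move: mp; rewrite mcoeff_msupp pm0 eqxx.
Qed.

(** If the last component vanished, so would that of the composite with the inverse; proportionality
    to the identity triple would then kill every component of this composite. *)
Lemma fwd2_neq0 (f : birrep K) : tnth (fwd f) 2 != 0.
Proof.
apply/eqP => F0; have [[i ni] p] := bwdK f; case/eqP: ni; apply/eqP.
have := p i 2; rewrite !tnth_mktuple F0 comp_mpoly0 mul0r => /eqP.
by rewrite mulf_eq0 (negbTE (X_neq0 _ _)) orbF.
Qed.

End FunctionField.

(** * Pullback of rational functions *)

(** Lets a function obtained by choice be used as a bundled morphism once its laws are proved. *)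
Lemma rmorphismP (A B : fieldType) (f : A -> B) :
  zmod_morphism f -> monoid_morphism f -> exists g : {rmorphism A -> B}, g =1 f.
Proof.
move=> fA fM.
pose mA := GRing.isZmodMorphism.Build A B f fA.
pose mM := GRing.isMonoidMorphism.Build A B f fM.
pose g : {rmorphism A -> B} := HB.pack f mA mM.
by exists g.
Qed.

Section Pullback.
Context (K L : fieldType) (D : {rmorphism {mpoly K[3]} -> L}).
Context (D_inj : forall d p, p \is d.-homog -> D p = 0 -> p = 0).
Context (D_X2 : D 'X_2 = 1).
Context (D_gen : forall S : L -> Prop, (forall c, S (D c%:MP)) -> S (D 'X_0) -> S (D 'X_1) ->
  (forall a b, S a -> S b -> S (a + b)) -> (forall a b, S a -> S b -> S (a * b)) ->
  (forall a, a != 0 -> S a -> S a^-1) -> forall z, S z).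
Local Notation X := (D 'X_0).
Local Notation Y := (D 'X_1).

Lemma D_inj2 d p q : p \is d.-homog -> q \is d.-homog -> D p = D q -> p = q.
Proof.
move=> hp hq e; apply/eqP; rewrite -subr_eq0; apply/eqP.
by apply: (@D_inj d); [rewrite rpredB|rewrite rmorphB /= e subrr].
Qed.

Lemma D_neq0 d p : p \is d.-homog -> p != 0 -> D p != 0.
Proof. by move=> hp; apply: contra_neq => /(D_inj hp). Qed.

(** Equal degrees make [P / Q] a function on the plane: replacing a triple by a proportional one
    does not change the composite quotient. *)
Definition hfrac (z : L) d (P Q : {mpoly K[3]}) :=
  [/\ P \is d.-homog, Q \is d.-homog, D Q != 0 & z = D P / D Q].

Lemma hfracM d P Q d' P' Q' z z' : hfrac z d P Q -> hfrac z' d' P' Q' ->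
  hfrac (z * z') (d + d') (P * P') (Q * Q').
Proof.
move=> [hP hQ Q0 ->] [hP' hQ' Q'0 ->].
by split; rewrite ?dhomogM // ?rmorphM ?mulf_neq0 // mulf_div.
Qed.

Lemma hfracD d P Q d' P' Q' z z' : hfrac z d P Q -> hfrac z' d' P' Q' ->
  hfrac (z + z') (d + d') (P * Q' + P' * Q) (Q * Q').
Proof.
move=> [hP hQ Q0 ->] [hP' hQ' Q'0 ->]; split; rewrite ?dhomogM //.
- by apply: dhomogD; [|rewrite addnC]; exact: dhomogM.
- by rewrite rmorphM mulf_neq0.
- by rewrite rmorphD !rmorphM addf_div.
Qed.

Lemma hfracN d P Q z : hfrac z d P Q -> hfrac (- z) d (- P) Q.
Proof. by move=> [hP hQ Q0 ->]; split; rewrite ?rpredN // rmorphN mulNr. Qed.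

Lemma hfracV d P Q z : z != 0 -> hfrac z d P Q -> hfrac z^-1 d Q P.
Proof.
move=> z0 [hP hQ Q0 e]; split=> //; last by rewrite e invf_div.
by apply: contra_neq z0 => P0; rewrite e P0 mul0r.
Qed.

Lemma hfrac_cst c : hfrac (D c%:MP) 0 c%:MP 1.
Proof.
split; rewrite ?dhomog1 ?rmorph1 ?oner_eq0 ?divr1 //.
by rewrite -[c%:MP]mulr1 mul_mpolyC; apply/dhomogZ/dhomog1.
Qed.

Lemma homogX (i : 'I_3) : ('X_i : {mpoly K[3]}) \is 1.-homog.
Proof. by rewrite dhomogX /= mdeg1. Qed.

Lemma hfrac_coord i : hfrac (D 'X_i) 1 'X_i 'X_2.
Proof. by split; rewrite ?homogX // D_X2 ?oner_eq0 // divr1. Qed.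

(** Quotients of forms of equal degree are closed under the field operations and contain the
    constants and both coordinates, which generate [L] by [D_gen]. *)
Lemma hfracP z : exists d P Q, hfrac z d P Q.
Proof.
elim/D_gen: z => [c|||a b|a b|a a0].
- by exists 0%N, c%:MP, 1; exact: hfrac_cst.
- by exists 1%N, 'X_0, 'X_2; exact: hfrac_coord.
- by exists 1%N, 'X_1, 'X_2; exact: hfrac_coord.
- by move=> [d [P [Q h]]] [d' [P' [Q' h']]]; do 3!eexists; exact: hfracD h h'.
- by move=> [d [P [Q h]]] [d' [P' [Q' h']]]; do 3!eexists; exact: hfracM h h'.
- by move=> [d [P [Q h]]]; do 3!eexists; exact: hfracV a0 h.
Qed.

(** A single form is viewed as the triple with three equal entries, so that the results on triples
    apply; the next two lemmas use the same device. *)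
Lemma homog_comp d e P (F : triple K) : P \is d.-homog -> homogeneous_triple e F ->
  P \mPo F \is (d * e).-homog.
Proof.
move=> hP hF; have hT : homogeneous_triple d [tuple P | i < 3] by move=> i; rewrite tnth_mktuple.
by have := homogeneous_comp hT hF ord0; rewrite !tnth_mktuple.
Qed.

Lemma comp_neq0 d P (f : birrep K) : P \is d.-homog -> P != 0 -> P \mPo fwd f != 0.
Proof.
move=> hP P0; have hT : homogeneous_triple d [tuple P | i < 3] by move=> i; rewrite tnth_mktuple.
have nT : nonzero_triple [tuple P | i < 3] by exists ord0; rewrite tnth_mktuple.
by have [k] := nonzero_comp hT nT (bwdK f); rewrite !tnth_mktuple.
Qed.

Lemma comp_assoc P (F G : triple K) : P \mPo comp_triple F G = (P \mPo F) \mPo G.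
Proof.
have := congr1 (fun T : triple K => tnth T ord0) (comp_tripleA [tuple P | i < 3] F G).
by rewrite !tnth_mktuple.
Qed.

Lemma comp_ratio d P Q (F G : triple K) : P \is d.-homog -> Q \is d.-homog ->
  nonzero_triple G -> proportional F G ->
  (P \mPo F) * (Q \mPo G) = (Q \mPo F) * (P \mPo G).
Proof.
move=> hP hQ nG FG.
have hT : homogeneous_triple d [tuple if i == 0 then P else Q | i < 3].
  by move=> i; rewrite tnth_mktuple; case: ifP.
by have := proportional_compr hT nG FG 0 1; rewrite !tnth_mktuple.
Qed.

Definition frep (f : Bir K) := fwd (repr f).

Lemma D_fwd2 (f : birrep K) : D (tnth (fwd f) 2) != 0.
Proof. by have [d hF] := fwd_homog f; apply: (D_neq0 (hF _)); exact: fwd2_neq0. Qed.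

Definition aff (f : Bir K) : L * L :=
  (D (tnth (frep f) 0) / D (tnth (frep f) 2), D (tnth (frep f) 1) / D (tnth (frep f) 2)).

Lemma ord3P (i : 'I_3) : [\/ i = 0, i = 1 | i = 2].
Proof. by case: i => [[|[|[|]]]] //= ?; [apply: Or31|apply: Or32|apply: Or33]; apply/val_inj. Qed.

Lemma proportional_ratio d e (F G : triple K) :
  homogeneous_triple d F -> homogeneous_triple e G ->
  D (tnth F 2) != 0 -> D (tnth G 2) != 0 ->
  D (tnth F 0) / D (tnth F 2) = D (tnth G 0) / D (tnth G 2) ->
  D (tnth F 1) / D (tnth F 2) = D (tnth G 1) / D (tnth G 2) -> proportional F G.
Proof.
move=> hf hg f2 g2 e0 e1.
have E i : D (tnth F i) = D (tnth G i) / D (tnth G 2) * D (tnth F 2).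
  by case: (ord3P i) => ->; rewrite -?e0 -?e1 ?divff // ?divfK // mul1r.
move=> i j; apply: (@D_inj2 (d + e)).
- exact: dhomogM.
- exact: dhomogM.
- by rewrite !rmorphM /= (E i) (E j); field.
Qed.

Lemma aff_inj : injective aff.
Proof.
move=> f g [e0 e1]; rewrite -[f]reprK -[g]reprK; apply/bir_eqP.
have [d hf] := fwd_homog (repr f); have [e hg] := fwd_homog (repr g).
exact: proportional_ratio hf hg (D_fwd2 _) (D_fwd2 _) e0 e1.
Qed.

(* [w = f^* z]. *)
Definition pull_rel (f : Bir K) (z w : L) := exists d P Q,
  hfrac z d P Q /\ w = D (P \mPo frep f) / D (Q \mPo frep f).

(** Independence of the choices: [D_inj2] turns equality of two fractions into an identity of forms,
    which survives composition with a triple, and [comp_ratio] changes the triple within its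
    proportionality class. *)
Lemma pull_relE f z w d P Q (r : birrep K) : pull_rel f z w -> hfrac z d P Q ->
  proportional (fwd r) (frep f) -> w = D (P \mPo fwd r) / D (Q \mPo fwd r).
Proof.
move=> [d' [P' [Q' [[hP' hQ' Q'0 zE'] ->]]]] [hP hQ Q0 zE] fr.
have [e hF] := fwd_homog (repr f); have [e' hF'] := fwd_homog r.
have Q0' : Q != 0 by apply: contra_neq Q0 => ->; rewrite rmorph0.
have Q'0' : Q' != 0 by apply: contra_neq Q'0 => ->; rewrite rmorph0.
have E : P * Q' = P' * Q.
  apply: (@D_inj2 (d + d')); [|rewrite addnC|]; try exact: dhomogM.
  by rewrite !rmorphM; move/eqP: zE; rewrite zE' eqr_div // => /eqP.
have nf := D_neq0 (homog_comp hQ' hF) (comp_neq0 (repr f) hQ' Q'0').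
have nr := D_neq0 (homog_comp hQ hF') (comp_neq0 r hQ Q0').
have nf' := D_neq0 (homog_comp hQ hF) (comp_neq0 (repr f) hQ Q0').
transitivity (D (P \mPo frep f) / D (Q \mPo frep f)).
  apply/eqP; rewrite eqr_div // -[X in X == _](rmorphM D) -[X in _ == X](rmorphM D).
  by rewrite -[X in D X == _](rmorphM (comp_mpoly _)) -[X in _ == D X](rmorphM (comp_mpoly _)) E.
apply/eqP; rewrite eqr_div // -[X in X == _](rmorphM D) -[X in _ == X](rmorphM D).
by rewrite (comp_ratio hP hQ (fwd_neq0 _) fr) [X in D X]mulrC.
Qed.

(** Values are picked by choice from [pull_rel]; by [pull_relE] they can be computed on any
    fraction, which yields the laws of a field morphism. Products are reversed, as [f * g] is [f]
    after [g]. *)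
Lemma pull_exists : exists pull : Bir K -> {rmorphism L -> L},
  [/\ forall f, aff f = (pull f X, pull f Y),
      forall f c, pull f (D c%:MP) = D c%:MP &
      forall f g z, pull (f * g)%g z = pull g (pull f z)].
Proof.
have [p pP] : exists p : Bir K -> L -> L, forall f z, pull_rel f z (p f z).
  have h f z : exists w, pull_rel f z w.
    by have [d [P [Q h]]] := hfracP z; eexists; exists d, P, Q.
  by exists (fun f z => projT1 (cid (h f z))) => f z; exact: (projT2 (cid (h f z))).
have pE f z d P Q : hfrac z d P Q -> p f z = D (P \mPo frep f) / D (Q \mPo frep f).
  by move=> h; apply: (pull_relE (pP f z) h); exact: proportional_refl.
have n0 f z d P Q : hfrac z d P Q -> D (Q \mPo frep f) != 0.
  move=> [_ hQ Q0 _]; have [e hF] := fwd_homog (repr f).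
  apply: (D_neq0 (homog_comp hQ hF)); apply: (comp_neq0 _ hQ).
  by apply: contra_neq Q0 => ->; rewrite rmorph0.
have qX f : exists q : {rmorphism L -> L}, q =1 p f.
  apply: rmorphismP; last split.
  - move=> a b; have [d [P [Q h]]] := hfracP a; have [d' [P' [Q' h']]] := hfracP b.
    rewrite (pE _ _ _ _ _ (hfracD h (hfracN h'))) (pE _ _ _ _ _ h) (pE _ _ _ _ _ h').
    have := n0 f _ _ _ _ h; have := n0 f _ _ _ _ h'.
    rewrite rmorphD !rmorphM rmorphN /= rmorphD /= !rmorphM /= rmorphN => *.
    by field; apply/andP.
  - rewrite (pE _ _ 0%N 1 1); first by rewrite rmorph1 divff ?rmorph1 ?oner_eq0.
    by split; rewrite ?dhomog1 ?rmorph1 ?oner_eq0 ?divr1.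
  - move=> a b; have [d [P [Q h]]] := hfracP a; have [d' [P' [Q' h']]] := hfracP b.
    rewrite (pE _ _ _ _ _ (hfracM h h')) (pE _ _ _ _ _ h) (pE _ _ _ _ _ h').
    by rewrite !rmorphM /= mulf_div.
exists (fun f => projT1 (cid (qX f))).
have qE f : projT1 (cid (qX f)) =1 p f by exact: (projT2 (cid (qX f))).
split.
- move=> f; rewrite !qE !(pE _ _ _ _ _ (hfrac_coord _)) !comp_mpolyXU -!tnth_nth.
  by [].
- by move=> f c; rewrite qE (pE _ _ _ _ _ (hfrac_cst c)) comp_mpolyC rmorph1 rmorph1 divr1.
- move=> f g z; rewrite !qE; have [d [P [Q h]]] := hfracP z.
  (* The chosen representative of the product is only proportional to the composite of the
     representatives. *)
  have fg : proportional (fwd (birrep_comp (repr f) (repr g))) (frep (f * g)%g).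
    exact/proportional_sym/bir_reprP.
  rewrite (pull_relE (pP _ _) h fg) /= !comp_assoc.
  have [hP hQ Q0 _] := h; have [e hF] := fwd_homog (repr f).
  rewrite (@pE g _ (d * e)%N (P \mPo frep f) (Q \mPo frep f)) //.
  by split; rewrite ?homog_comp ?(n0 _ _ _ _ _ h) // (pE _ _ _ _ _ h).
Qed.

(** Up to its last component, [F] is the triple (Phi X : Phi Y : 1), so composing a form with it
    amounts to applying [Phi]; homogeneity collects the common factor. *)
Lemma D_comp (F : triple K) P d (Phi : {rmorphism L -> L}) :
  P \is d.-homog -> (forall c, Phi (D c%:MP) = D c%:MP) ->
  (forall i, D (tnth F i) = D (tnth F 2) * Phi (D 'X_i)) ->
  D (P \mPo F) = D (tnth F 2) ^+ d * Phi (D P).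
Proof.
move=> hP Phic FE; rewrite -[P in RHS]comp_mpoly_id !comp_mpolyE !rmorph_sum mulr_sumr.
apply: eq_big_seq => m mP /=; rewrite -!mul_mpolyC !rmorphM Phic mulrCA; congr (_ * _).
rewrite !rmorph_prod /= -(dhomog_mf hP mP) /= mdegE.
under eq_bigr do rewrite rmorphXn FE exprMn.
rewrite big_split /= prodrXr; congr (_ * _); apply: eq_bigr => i _.
by rewrite tnth_mktuple !rmorphXn.
Qed.

Lemma hfrac_triple a b : exists d (F : triple K), [/\ homogeneous_triple d F,
  D (tnth F 2) != 0, D (tnth F 0) = D (tnth F 2) * a & D (tnth F 1) = D (tnth F 2) * b].
Proof.
have [d [P [Q [hP hQ Q0 ->]]]] := hfracP a; have [e [P' [Q' [hP' hQ' Q'0 ->]]]] := hfracP b.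
exists (d + e)%N, [tuple P * Q'; P' * Q; Q * Q']; rewrite !(tnth_nth 0) /= !rmorphM.
split; last by field.
- by move=> i; rewrite (tnth_nth 0); case: (ord3P i) => -> /=; rewrite 1?[P' * Q]mulrC; exact: dhomogM.
- by rewrite mulf_neq0.
- by field.
Qed.

(** By [D_comp], all components of the composite are the [X_i] times one common nonzero factor. *)
Lemma inverse_triplesP (F G : triple K) d e (Phi : {rmorphism L -> L}) :
  homogeneous_triple d F -> homogeneous_triple e G ->
  D (tnth F 2) != 0 -> D (tnth G 2) != 0 ->
  (forall c, Phi (D c%:MP) = D c%:MP) ->
  (forall i, D (tnth F i) = D (tnth F 2) * Phi (D 'X_i)) ->
  (forall i, Phi (D (tnth G i)) = Phi (D (tnth G 2)) * D 'X_i) ->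
  inverse_triples G F.
Proof.
move=> hF hG F2 G2 Phic FE GE.
have E i : D (tnth (comp_triple G F) i) = D (tnth F 2) ^+ e * Phi (D (tnth G 2)) * D 'X_i.
  by rewrite tnth_mktuple (D_comp (hG i) Phic FE) GE mulrA.
split.
  exists 2; have : D (tnth (comp_triple G F) 2) != 0.
    by rewrite E D_X2 mulr1 mulf_neq0 ?expf_neq0 ?fmorph_eq0.
  by apply: contra_neq => ->; rewrite rmorph0.
have hGF := homogeneous_comp hG hF.
move=> i j; rewrite ![tnth (id_triple K) _]tnth_mktuple; apply: (@D_inj2 (e * d + 1)).
- by apply: dhomogM => //; exact: homogX.
- by apply: dhomogM => //; exact: homogX.
- by rewrite !rmorphM /= (E i) (E j) mulrAC.
Qed.

(** Converse of the pullback construction: clearing denominators in the images of X and Y under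
    [Phi] gives the triple of the map, and under [Psi] that of its inverse. *)
Lemma bir_of_automorphism (Phi Psi : {rmorphism L -> L}) :
  (forall c, Phi (D c%:MP) = D c%:MP) -> (forall c, Psi (D c%:MP) = D c%:MP) ->
  Phi (Psi X) = X -> Phi (Psi Y) = Y -> Psi (Phi X) = X -> Psi (Phi Y) = Y ->
  exists h, aff h = (Phi X, Phi Y).
Proof.
move=> Phic Psic PX PY QX QY.
have [d [F [hF F2 F0 F1]]] := hfrac_triple (Phi X) (Phi Y).
have [e [G [hG G2 G0 G1]]] := hfrac_triple (Psi X) (Psi Y).
have FE i : D (tnth F i) = D (tnth F 2) * Phi (D 'X_i).
  by case: (ord3P i) => ->; rewrite ?F0 ?F1 // D_X2 rmorph1 mulr1.
have GE i : D (tnth G i) = D (tnth G 2) * Psi (D 'X_i).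
  by case: (ord3P i) => ->; rewrite ?G0 ?G1 // D_X2 rmorph1 mulr1.
have FE' i : Psi (D (tnth F i)) = Psi (D (tnth F 2)) * D 'X_i.
  by rewrite FE rmorphM; case: (ord3P i) => ->; rewrite ?QX ?QY // D_X2 !rmorph1.
have GE' i : Phi (D (tnth G i)) = Phi (D (tnth G 2)) * D 'X_i.
  by rewrite GE rmorphM; case: (ord3P i) => ->; rewrite ?PX ?PY // D_X2 !rmorph1.
have GF := inverse_triplesP hF hG F2 G2 Phic FE GE'.
have FG := inverse_triplesP hG hF G2 F2 Psic GE FE'.
pose r := BirRep (ex_intro (fun n => homogeneous_triple n F) d hF)
  (ex_intro (fun n => homogeneous_triple n G) e hG) GF FG.
exists (\pi_(Bir K) r).
have := bir_reprP r; have := D_fwd2 (repr (\pi_(Bir K) r)).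
rewrite /aff /frep; set H := fwd (repr _) => H2 p.
have E i : D (tnth H i) / D (tnth H 2) = Phi (D 'X_i).
  have := congr1 D (p i 2); rewrite !rmorphM /= (FE i) => e1.
  apply: (mulfI (mulf_neq0 F2 H2)).
  by transitivity (D (tnth H i) * D (tnth F 2)); [field|rewrite e1; ring].
by rewrite !E.
Qed.

End Pullback.

(** * One-parameter subgroups of PGL_2 *)
Section Cofinite.
Context (C : numFieldType).
Implicit Types P Q : C -> Prop.

(** The general parameter: rationality in [t] gives identities only away from finitely many
    values. *)
Definition cofinite P := exists s : seq C, forall t, t \notin s -> P t.

Lemma cofinite_and P Q : cofinite P -> cofinite Q -> cofinite (fun t => P t /\ Q t).
Proof.
by move=> [s hs] [r hr]; exists (s ++ r) => t; rewrite mem_cat negb_or => /andP[/hs ? /hr].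
Qed.

Lemma cofinite_sub P Q : (forall t, P t -> Q t) -> cofinite P -> cofinite Q.
Proof. by move=> h [s hs]; exists s => t /hs /h. Qed.

Lemma cofinite_sub2 P Q S : (forall t, P t -> Q t -> S t) ->
  cofinite P -> cofinite Q -> cofinite S.
Proof. by move=> h cP cQ; apply: cofinite_sub (cofinite_and cP cQ) => t []; exact: h. Qed.

Lemma cofinite_shift P u : cofinite P -> cofinite (fun t => P (t + u)).
Proof.
move=> [s hs]; exists [seq x - u | x <- s] => t ts; apply: hs; apply: contra ts => ts.
by apply/mapP; exists (t + u); rewrite ?addrK.
Qed.

Lemma cofinite_neq u : cofinite (fun t => t != u).
Proof. by exists [:: u] => t; rewrite inE. Qed.

(** In characteristic zero the natural numbers form an infinite set, so a general parameter can be
    found among them. *)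
Lemma cofinite_nat P : cofinite P -> exists n : nat, P n%:R.
Proof.
move=> [s hs]; apply: contrapT => noP.
have sub : {subset [seq i%:R | i <- iota 0 (size s).+1] <= s}.
  move=> x /mapP[i _ ->]; apply: contrapT => /negP si; apply: noP; exists i; exact: hs.
suff /uniq_leq_size/(_ sub) : uniq [seq (i%:R : C) | i <- iota 0 (size s).+1].
  by rewrite size_map size_iota ltnn.
by rewrite map_inj_uniq ?iota_uniq // => i j /eqP; rewrite eqr_nat => /eqP.
Qed.

End Cofinite.

(** * Polynomials determined by their values at general parameters *)

Section CofinitePoly.
Context (C : numFieldType) (F : fieldType) (io : {rmorphism C -> F}).

(** Induction on a bound for the size: a root in the image of [io] is split off, and excluded from
    the parameters. *)
Lemma cofinite_root (p : {poly F}) : p != 0 -> cofinite (fun t => p.[io t] != 0).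
Proof.
elim: {p}(size p) {-2}p (leqnn (size p)) => [|n IH] p sp p0.
  by move: sp; rewrite leqn0 size_poly_eq0 (negbTE p0).
case: (EM (exists t, root p (io t))) => [[t]|no]; last first.
  by exists [::] => t _; apply/negP => rt; apply: no; exists t.
move=> /factor_theorem [q pE]; have q0 : q != 0 by apply: contra_neq p0 => q0; rewrite pE q0 mul0r.
have [|s hs] := IH q _ q0.
  by move: sp; rewrite pE size_Mmonic ?monicXsubC // size_XsubC addn2.
exists (t :: s) => x; rewrite inE negb_or => /andP[xt /hs qx].
by rewrite pE hornerM mulf_neq0 // hornerXsubC subr_eq0 fmorph_eq.
Qed.

Lemma cofinite_poly_eq (p q : {poly F}) : cofinite (fun t => p.[io t] = q.[io t]) -> p = q.
Proof.
move=> h; apply/eqP; rewrite -subr_eq0; apply/negPn/negP => /cofinite_root n0.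
have [n [e]] := cofinite_nat (cofinite_and h n0).
by rewrite hornerD hornerN e subrr eqxx.
Qed.

(** Variant for an additive function, whose values are at first known only at natural numbers. *)
Lemma cofinite_poly_eq_nat (p q : {poly F}) (P : C -> Prop) : cofinite P ->
  (forall n : nat, P n%:R -> p.[n%:R] = q.[n%:R]) -> p = q.
Proof.
move=> cP h; apply/eqP; rewrite -subr_eq0; apply/negPn/negP => /cofinite_root n0.
have [n [/h e]] := cofinite_nat (cofinite_and cP n0).
by rewrite rmorph_nat hornerD hornerN e subrr eqxx.
Qed.

End CofinitePoly.

(** * Polynomials in two variables and their values *)

Section Bivariate.
Context (C : numFieldType).

Lemma poly2_neq0 (p : {poly {poly C}}) : p != 0 -> exists x y, p.[x%:P].[y] != 0.
Proof.
move=> p0; have lp : lead_coef p != 0 by rewrite lead_coef_eq0.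
have [m lm] := cofinite_nat (cofinite_root idfun lp).
pose q := map_poly (horner_eval (m%:R : C)) p.
have q0 : q != 0.
  by apply: contra_neq lm => q0; rewrite lead_coefE -/(horner_eval _ _) -coef_map -/q q0 coef0.
have [n qn] := cofinite_nat (cofinite_root idfun q0); exists n%:R, m%:R.
suff <- : q.[n%:R] = p.[n%:R%:P].[m%:R] by [].
by rewrite -[in LHS](hornerC n%:R m%:R) -[RHS]/(horner_eval _ _) -horner_map.
Qed.

(** Density of the complement of a curve: [n * (p - q)] vanishes at every point. *)
Lemma poly2_eq (p q n : {poly {poly C}}) : n != 0 ->
  (forall x y, n.[x%:P].[y] != 0 -> p.[x%:P].[y] = q.[x%:P].[y]) -> p = q.
Proof.
move=> n0 h; apply: (mulfI n0); apply/eqP; rewrite -subr_eq0; apply/negPn/negP => /poly2_neq0[x [y]].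
rewrite !(hornerD, hornerN, hornerM); have [->|/h ->] := eqVneq n.[x%:P].[y] 0.
  by rewrite !mul0r subrr eqxx.
by rewrite subrr eqxx.
Qed.

End Bivariate.

(** * Top coefficients, in place of limits for t tending to infinity *)

Section TopCoefficients.
Context (F : fieldType).
Implicit Types p q : {poly F}.

(** The size bounds need not be sharp: a vanishing coefficient at [n] or [m] is allowed, as happens
    when only one of two coordinates has maximal degree. *)
Lemma coefM_top p q n m : (size p <= n.+1)%N -> (size q <= m.+1)%N ->
  (p * q)`_(n + m) = p`_n * q`_m.
Proof.
move=> sp sq; rewrite coefM (bigD1 (Ordinal (leq_addr m n.+1))) //= addKn big1 ?addr0 // => i ni.
case: (ltnP n i) => [lni|lin].
  by rewrite [p`_i]nth_default ?mul0r // (leq_trans sp).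
have {}lin : (i < n)%N by rewrite ltn_neqAle lin andbT -val_eqE in ni *.
rewrite [q`_(_ - _)]nth_default ?mulr0 // (leq_trans sq) //.
by rewrite ltn_subRL ltn_add2r.
Qed.

Definition shift c p := p \Po ('X + c%:P).

Lemma horner_shift c p t : (shift c p).[t] = p.[t + c].
Proof. by rewrite horner_comp !hornerE. Qed.

Lemma size_shift c p : size (shift c p) = size p.
Proof. by rewrite size_comp_poly2 // size_XaddC. Qed.

Lemma coef_shift_top c p n : (size p <= n.+1)%N -> (shift c p)`_n = p`_n.
Proof.
rewrite leq_eqVlt => /orP[/eqP sp|sp]; last by rewrite !nth_default ?size_shift.
have := lead_coef_comp p (q := 'X + c%:P); rewrite size_XaddC => /(_ isT).
by rewrite lead_coefXaddC expr1n mulr1 !lead_coefE size_shift sp.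
Qed.

End TopCoefficients.

(** * Two by two matrices *)

Section Matrix2.
Context (F : fieldType).
Implicit Types (A B : 'M[F]_2).

Lemma ord2P (i : 'I_2) : i = 0 \/ i = 1.
Proof. by case: i => [[|[|]]] //= ?; [left|right]; apply/val_inj. Qed.

Lemma mulmx2E (R : nzSemiRingType) (n p : nat) (A : 'M[R]_(n, 2)) (B : 'M[R]_(2, p)) i j :
  (A *m B) i j = A i 0 * B 0 j + A i 1 * B 1 j.
Proof.
rewrite mxE !big_ord_recl big_ord0 addr0.
by have -> : lift ord0 ord0 = 1 :> 'I_2 by apply/val_inj.
Qed.

Lemma det2E (R : comNzRingType) (A : 'M[R]_2) : \det A = A 0 0 * A 1 1 - A 0 1 * A 1 0.
Proof.
rewrite (expand_det_row _ 0) !big_ord_recl big_ord0 addr0.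
have -> : lift ord0 ord0 = 1 :> 'I_2 by apply/val_inj.
rewrite /cofactor !det_mx11 !mxE /= expr0 expr1 mul1r mulN1r mulrN.
congr (_ * _ - _ * _); congr (A _ _); exact/val_inj.
Qed.

Definition mx2 (R : Type) (a b c d : R) : 'M[R]_2 :=
  \matrix_(i, j) (if i == 0 then if j == 0 then a else b else if j == 0 then c else d).

Lemma eqmx2 A B : A 0 0 = B 0 0 -> A 0 1 = B 0 1 -> A 1 0 = B 1 0 -> A 1 1 = B 1 1 -> A = B.
Proof. by move=> *; apply/matrixP => i j; case: (ord2P i) => ->; case: (ord2P j) => ->. Qed.

End Matrix2.

(** Equality of classes in PGL_n. *)
Definition projeq (F : fieldType) n (A B : 'M[F]_n) := exists2 k : F, k != 0 & A = k *: B.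

(** * Moebius transformations depending on a parameter *)

Section Moebius.
Context (C : numFieldType) (F : fieldType) (io : {rmorphism C -> F}).

(* The graph of [X |-> M X] over F(X), cleared of denominators. *)
Definition moebius_graph (M : 'M[F]_2) (P Q : {poly F}) :=
  (M 0 0 *: 'X + (M 0 1)%:P) * Q = (M 1 0 *: 'X + (M 1 1)%:P) * P.

Definition mxhorner (MM : 'M[{poly F}]_2) (t : F) : 'M[F]_2 := map_mx (horner_eval t) MM.

Lemma mxhornerE MM t i j : mxhorner MM t i j = (MM i j).[t].
Proof. by rewrite mxE. Qed.

(** The coefficients of degree 2 and 0 say that corresponding columns of [A] and [B] are parallel;
    the one of degree 1 gives [(k - l) * \det B = 0] for the two factors. *)
Lemma projeq_graph (A B : 'M[F]_2) : \det A != 0 -> \det B != 0 ->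
  moebius_graph A (B 0 0 *: 'X + (B 0 1)%:P) (B 1 0 *: 'X + (B 1 1)%:P) -> projeq A B.
Proof.
rewrite /moebius_graph !det2E => dA dB h.
have prodE (a b c d : F) : (a *: 'X + b%:P) * (c *: 'X + d%:P) =
    (a * c)%:P * 'X^2 + (a * d + b * c)%:P * 'X + (b * d)%:P.
  by rewrite -!mul_polyC !polyCD !polyCM; ring.
have coefE2 (a b c : F) : (a%:P * 'X^2 + b%:P * 'X + c%:P)`_2 = a.
  by rewrite !coefD !coefCM coefXn coefX coefC /= mulr1 mulr0 !addr0.
have coefE1 (a b c : F) : (a%:P * 'X^2 + b%:P * 'X + c%:P)`_1 = b.
  by rewrite !coefD !coefCM coefXn coefX coefC /= mulr1 mulr0 addr0 add0r.
have coefE0 (a b c : F) : (a%:P * 'X^2 + b%:P * 'X + c%:P)`_0 = c.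
  by rewrite !coefD !coefCM coefXn coefX coefC /= !mulr0 !add0r.
move: h; rewrite !prodE => h.
have e2 : A 0 0 * B 1 0 = A 1 0 * B 0 0.
  by have := congr1 (fun p : {poly F} => p`_2) h; rewrite !coefE2.
have e1 : A 0 0 * B 1 1 + A 0 1 * B 1 0 = A 1 0 * B 0 1 + A 1 1 * B 0 0.
  by have := congr1 (fun p : {poly F} => p`_1) h; rewrite !coefE1.
have e0 : A 0 1 * B 1 1 = A 1 1 * B 0 1.
  by have := congr1 (fun p : {poly F} => p`_0) h; rewrite !coefE0.
pose D := B 0 0 * B 1 1 - B 0 1 * B 1 0.
have parallel (x y u v : F) : x * v = y * u -> (u != 0) || (v != 0) -> exists k, x = k * u /\ y = k * v.
  move=> e /orP[u0|v0]; [exists (x / u)|exists (y / v)]; split; rewrite ?divfK //.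
    by apply: (mulfI u0); rewrite mulrC -e; field.
  by apply: (mulIf v0); rewrite e; field.
have [k [a c]] : exists k, A 0 0 = k * B 0 0 /\ A 1 0 = k * B 1 0.
  apply: parallel => //; apply: contraR dB; rewrite negb_or !negbK => /andP[/eqP -> /eqP ->].
  by rewrite mul0r mulr0 subrr.
have [l [b d]] : exists k, A 0 1 = k * B 0 1 /\ A 1 1 = k * B 1 1.
  apply: parallel => //; apply: contraR dB; rewrite negb_or !negbK => /andP[/eqP -> /eqP ->].
  by rewrite mul0r mulr0 subrr.
have kl : k = l.
  apply/eqP; rewrite -subr_eq0; apply/eqP; apply: (mulIf dB); rewrite mul0r.
  by move/eqP: e1; rewrite a b c d -subr_eq0 => /eqP <-; ring.
exists k.
  by apply: contra_neq dA => k0; rewrite a c k0; ring.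
by apply: eqmx2; rewrite !mxE ?a ?b ?c ?d kl.
Qed.

(** The order is that of substitutions: if [sigma s] fixes the entries of [M t], it sends M_t x to
    M_t (M_s x). *)
Definition one_parameter (M : C -> 'M[F]_2) := forall s t, projeq (M (s + t)) (M t *m M s).

Definition rational_family (M : C -> 'M[F]_2) (MM : 'M[{poly F}]_2) :=
  \det MM != 0 /\ cofinite (fun t => projeq (M t) (mxhorner MM (io t))).

(* A Moebius transformation is determined by its values at three points u0, u1,
   u2; clearing denominators in the formula for its matrix gives MM. *)
Lemma moebius_rational (M : C -> 'M[F]_2) (P Q : {poly {poly F}}) :
  (forall t, \det (M t) != 0) -> Q != 0 ->
  cofinite (fun t => moebius_graph (M t) P.[(io t)%:P] Q.[(io t)%:P]) ->
  exists MM, rational_family M MM.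
Proof.
move=> Mdet Q0 hPQ.
pose p (u : F) : {poly F} := map_poly (horner_eval u) P.
pose q (u : F) : {poly F} := map_poly (horner_eval u) Q.
have pE u t : (p u).[t] = P.[t%:P].[u].
  by rewrite -[in LHS](hornerC t u) -[RHS]/(horner_eval u P.[t%:P]) -horner_map.
have qE u t : (q u).[t] = Q.[t%:P].[u].
  by rewrite -[in LHS](hornerC t u) -[RHS]/(horner_eval u Q.[t%:P]) -horner_map.
have q_neq0 : cofinite (fun u => q (io u) != 0).
  have lQ : lead_coef Q != 0 by rewrite lead_coef_eq0.
  apply: cofinite_sub (cofinite_root io lQ) => u; apply: contra_neq => q0.
  by have := coef_map (horner_eval (io u)) Q (size Q).-1; rewrite -/(q _) q0 coef0 -lead_coefE.
have [n0 qn0] := cofinite_nat q_neq0.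
have [n1 [qn1 n10]] := cofinite_nat (cofinite_and q_neq0 (cofinite_neq n0%:R)).
have [n2 [qn2 [n20 n21]]] := cofinite_nat (cofinite_and q_neq0
  (cofinite_and (cofinite_neq n0%:R) (cofinite_neq n1%:R))).
have io_neq x y : x != y -> io x - io y != 0 by rewrite subr_eq0 fmorph_eq.
have u10 := io_neq _ _ n10; have u20 := io_neq _ _ n20; have u21 := io_neq _ _ n21.
set u0 := io _ in qn0 u10 u20; set u1 := io _ in qn1 u10 u21; set u2 := io _ in qn2 u20 u21.
(* The values at [u0] and [u1] are known only up to scalars. Comparison with [u2] gives factors [E0]
   and [E1] that make the two scalars equal; the columns of the matrix then follow by linear
   interpolation. *)
pose E0 := (u0 - u2)%:P * (p u1 * q u2 - p u2 * q u1).
pose E1 := (u1 - u2)%:P * (p u0 * q u2 - p u2 * q u0).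
pose MM := mx2 (E0 * p u0 - E1 * p u1) (u0%:P * (E1 * p u1) - u1%:P * (E0 * p u0))
               (E0 * q u0 - E1 * q u1) (u0%:P * (E1 * q u1) - u1%:P * (E0 * q u0)).
have scale u t : moebius_graph (M t) P.[(io t)%:P] Q.[(io t)%:P] -> (q u).[io t] != 0 ->
    exists k, [/\ k != 0, (p u).[io t] = k * (M t 0 0 * u + M t 0 1) &
      (q u).[io t] = k * (M t 1 0 * u + M t 1 1)].
  move=> /(congr1 (horner^~ u)); rewrite !hornerM !hornerD !hornerZ !hornerC !hornerX -pE -qE.
  (* A zero of the denominator at [u] would, by the graph equation, be a zero of the numerator as
     well, against invertibility. *)
  move=> e q0; have d0 : M t 1 0 * u + M t 1 1 != 0.
    apply/eqP => d0; move/eqP: e; rewrite d0 mul0r mulf_eq0 (negbTE q0) orbF => /eqP n0'.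
    have := Mdet t; rewrite det2E; apply/negP; rewrite negbK; apply/eqP.
    case: (eqVneq u 0) => [uz|uz].
      by move: n0' d0; rewrite uz !mulr0 !add0r => -> ->; rewrite mulr0 mul0r subrr.
    have -> : M t 0 1 = - (M t 0 0 * u) by apply/eqP; rewrite -addr_eq0 addrC n0'.
    have -> : M t 1 1 = - (M t 1 0 * u) by apply/eqP; rewrite -addr_eq0 addrC d0.
    by ring.
  exists ((q u).[io t] / (M t 1 0 * u + M t 1 1)); split.
  - by rewrite mulf_neq0 ?invr_eq0.
  - by apply: (mulfI d0); rewrite -e; field.
  - by rewrite divfK.
have fam : cofinite (fun t => projeq (mxhorner MM (io t)) (M t)).
  apply: cofinite_sub (cofinite_and hPQ (cofinite_and (cofinite_root io qn0)
    (cofinite_and (cofinite_root io qn1) (cofinite_root io qn2)))).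
  move=> t [g [/(scale _ _ g)[k0 [k00 p0 q0]] [/(scale _ _ g)[k1 [k10 p1 q1]]
    /(scale _ _ g)[k2 [k20 p2 q2]]]]].
  exists (k0 * k1 * k2 * \det (M t) * (u0 - u2) * (u1 - u2) * (u0 - u1)).
    by rewrite !mulf_neq0 // -opprB oppr_eq0.
  by rewrite det2E; apply: eqmx2; rewrite mxhornerE !mxE /= !(hornerD, hornerN, hornerM, hornerC)
    p0 p1 p2 q0 q1 q2; ring.
exists MM; split.
  have [n [k k0 e]] := cofinite_nat fam; apply/eqP => d0.
  have : \det (mxhorner MM (io n%:R)) != 0 by rewrite e detZ mulf_neq0 ?expf_neq0.
  by rewrite det_map_mx d0 rmorph0 eqxx.
apply: cofinite_sub fam => t [k k0 ->]; exists k^-1; rewrite ?invr_eq0 //.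
by rewrite scalerA mulVf // scale1r.
Qed.

(* As t tends to infinity, [M t u] tends to a point fixed by the whole group. *)
Lemma common_fixed_point (M : C -> 'M[F]_2) MM : one_parameter M -> rational_family M MM ->
  exists v : 'cV[F]_2, v != 0 /\
    forall s, (M s *m v) 0 0 * v 1 0 = (M s *m v) 1 0 * v 0 0.
Proof.
move=> Mop [MMdet MMM].
pose a := MM 0 0; pose c := MM 1 0; pose n := (maxn (size a) (size c)).-1.
have ac0 : (a != 0) || (c != 0).
  apply: contraR MMdet; rewrite negb_or !negbK det2E -/a -/c => /andP[/eqP -> /eqP ->].
  by rewrite mul0r mulr0 subrr.
have n1 : maxn (size a) (size c) = n.+1.
  by rewrite /n prednK // leq_max !size_poly_gt0.
have sa : (size a <= n.+1)%N by rewrite -n1 leq_maxl.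
have sc : (size c <= n.+1)%N by rewrite -n1 leq_maxr.
(* The first column of [MM] is the image of the point (1 : 0) under M_t; its coefficients of the
   maximal degree [n] give the limit point. *)
exists (\col_i (if i == 0 then a`_n else c`_n)); split.
  apply: contraTneq ac0 => /colP h; move: (h 0) (h 1); rewrite !mxE /= => a0 c0.
  rewrite negb_or !negbK; move: n1; rewrite /maxn; case: ltnP => _ e.
    have : c == 0 by rewrite -lead_coef_eq0 lead_coefE e /= c0.
    by move/eqP => c00; move: e; rewrite c00 size_poly0.
  have : a == 0 by rewrite -lead_coef_eq0 lead_coefE e /= a0.
  by move/eqP => a00; move: e; rewrite a00 size_poly0.
move=> s; rewrite !mulmx2E !mxE /=.
(* M_s maps the image of (1 : 0) under M_t to its image under M_(t+s), written as a polynomial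
   identity in t. *)
have E : (M s 0 0 *: a + M s 0 1 *: c) * shift (io s) c =
         (M s 1 0 *: a + M s 1 1 *: c) * shift (io s) a.
  apply: (cofinite_poly_eq (io := io)).
  apply: cofinite_sub2 MMM (cofinite_shift s MMM) => t [k k0 e1] [l l0 e2].
  rewrite !hornerM !hornerD !hornerZ !horner_shift -rmorphD.
  have [m m0 e3] := Mop t s; move: e3; rewrite e1 e2 -scalemxAr scalerA => e3.
  have L0 (i : 'I_2) : l * (MM i 0).[io (t + s)] = m * k * (M s i 0 * a.[io t] + M s i 1 * c.[io t]).
    by have := congr1 (fun A : 'M_2 => A i 0) e3; rewrite !mxE big_ord_recl big_ord1 !mxE
      (_ : lift _ _ = 1) //; exact/val_inj.
  have La := L0 0; have Lc := L0 1.
  apply: (mulfI (mulf_neq0 l0 (mulf_neq0 m0 k0))).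
  transitivity ((m * k * (M s 0 0 * a.[io t] + M s 0 1 * c.[io t])) * (l * c.[io (t + s)])).
    by ring.
  by rewrite -La Lc; ring.
have /= := congr1 (fun p : {poly F} => p`_(n + n)) E; rewrite !coefM_top ?size_shift //.
- by rewrite !coefD !coefZ !coef_shift_top.
- by rewrite (leq_trans (size_polyD _ _)) // geq_max !(leq_trans (size_scale_leq _ _)).
- by rewrite (leq_trans (size_polyD _ _)) // geq_max !(leq_trans (size_scale_leq _ _)).
Qed.

Lemma one_parameter_triangular (M : C -> 'M[F]_2) MM :
  (forall t, \det (M t) != 0) -> (forall t, M t 1 0 = 0) ->
  one_parameter M -> rational_family M MM ->
  exists b, forall t, projeq (M t) (mx2 1 (b * io t) 0 1).
Proof.
move=> Mdet M10 Mop [MMdet MMM].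
pose a t := M t 0 0; pose b t := M t 0 1; pose d t := M t 1 1.
have ad0 t : a t != 0 /\ d t != 0.
  by have := Mdet t; rewrite det2E M10 mulr0 subr0 mulf_eq0 negb_or => /andP.
have op s t : exists k, [/\ k != 0, a (s + t) = k * (a t * a s),
    b (s + t) = k * (a t * b s + b t * d s) & d (s + t) = k * (d t * d s)].
  have [k k0 e] := Mop s t; exists k; have eE i j : M (s + t) i j = k * (M t *m M s) i j.
    by rewrite e mxE.
  by split; rewrite // /a /b /d eE mulmx2E ?M10 ?mulr0 ?mul0r ?addr0 ?add0r.
pose A := MM 0 0; pose B := MM 0 1; pose E := MM 1 1.
have fam : cofinite (fun t => E.[io t] != 0 /\
    (A.[io t] = a t / d t * E.[io t] /\ B.[io t] = b t / d t * E.[io t])).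
  apply: cofinite_sub MMM => t [k k0 e].
  have eE i j : M t i j = k * (MM i j).[io t] by rewrite e mxE mxhornerE.
  have [a0 d0] := ad0 t; rewrite /a /b /d !eE in a0 d0 *; rewrite -/A -/B -/E in a0 d0 *.
  have E0 : E.[io t] != 0 by apply: contra_neq d0 => ->; rewrite mulr0.
  by split=> //; split; field; rewrite k0 E0.
have E0 : E != 0.
  have [n [e _]] := cofinite_nat fam.
  by apply: contra_neq e => ->; rewrite horner0.
have A0 : A != 0.
  have [n [e [e' _]]] := cofinite_nat fam.
  have [a0 d0] := ad0 n%:R; apply/eqP => A0; move/eqP: e'.
  by rewrite A0 horner0 eq_sym !mulf_eq0 invr_eq0 (negbTE a0) (negbTE d0) (negbTE e).
(* The ratio a / d is multiplicative, so A(t + s) E(t) is a_s / d_s times A(t) E(t + s); a shift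
   preserves leading coefficients, which forces the factor to be 1. *)
have ad s : a s = d s.
  have eq1 : shift (io s) A * E = (a s / d s) *: (A * shift (io s) E).
    apply: (cofinite_poly_eq (io := io)).
    apply: cofinite_sub2 fam (cofinite_shift s fam) => t [_ [e1 _]] [_ [e2 _]].
    rewrite hornerZ !hornerM !horner_shift -rmorphD e1 e2.
    have [k [k0 -> _ ->]] := op t s; have [? ?] := ad0 t; have [? ?] := ad0 s.
    by field; rewrite k0; apply/and3P; split.
  have /= := congr1 (fun p : {poly F} => p`_((size A).-1 + (size E).-1)) eq1.
  rewrite coefZ !coefM_top ?size_shift ?prednK ?size_poly_gt0 ?leqSpred //.
  rewrite !coef_shift_top ?leqSpred // -!lead_coefE => e.
  have l0 : lead_coef A * lead_coef E != 0 by rewrite mulf_neq0 ?lead_coef_eq0.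
  have [a0 d0] := ad0 s; apply: (mulIf (invr_neq0 d0)); rewrite divff //.
  by apply: (mulIf l0); rewrite -e mul1r.
pose u t := b t / d t.
have uD s t : u (s + t) = u s + u t.
  rewrite /u; have [k [k0 _ -> ->]] := op s t; rewrite !ad.
  by have [_ ds] := ad0 s; have [_ dt] := ad0 t; field; rewrite k0 ds dt.
have un (n : nat) : u n%:R = u 1 * n%:R.
  elim: n => [|n IH]; first by rewrite mulr0; apply: (addIr (u 0)); rewrite -uD !add0r.
  by rewrite -addn1 natrD uD IH natrD mulrDr mulr1.
(* Additivity determines [u] on the natural numbers, and these suffice to identify the polynomial
   [B]. *)
have BE : B = u 1 *: ('X * E).
  apply: (cofinite_poly_eq_nat io fam) => n [_ [_ e]].
  by rewrite hornerZ hornerM hornerX -[n%:R in LHS](rmorph_nat io) e -/(u _) un rmorph_nat mulrA.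
have uE : cofinite (fun t => u t = u 1 * io t).
  apply: cofinite_sub fam => t [e0 [_ e]]; apply: (mulIf e0).
  by rewrite -/(u t) in e; rewrite -e BE hornerZ hornerM hornerX mulrA.
exists (u 1) => t; exists (d t); first by case: (ad0 t).
have {}uE : u t = u 1 * io t.
  (* An exceptional [t] is the difference of two general parameters, [n + t] and [n]. *)
  have [n [e1 e2]] := cofinite_nat (cofinite_and uE (cofinite_shift t uE)).
  by apply: (addrI (u n%:R)); rewrite -uD e2 e1 rmorphD mulrDr.
have [_ d0] := ad0 t.
apply: eqmx2; rewrite !mxE /= -?uE ?mulr1 ?mulr0 ?M10 //; first exact: ad.
by rewrite /u mulrCA divff ?mulr1.
Qed.

(** Conjugation by a matrix moving the common fixed point to (1 : 0) reduces to the triangular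
    case. *)
Lemma one_parameter_unipotent (M : C -> 'M[F]_2) MM :
  (forall t, \det (M t) != 0) -> one_parameter M -> rational_family M MM ->
  exists S b, \det S != 0 /\ forall t, projeq (S *m M t) (mx2 1 (b * io t) 0 1 *m S).
Proof.
move=> Mdet Mop MMM; have [v [v0 fixv]] := common_fixed_point Mop MMM.
(* [S] exchanges the coordinates if [v] is (0 : 1), and otherwise subtracts a multiple of the first
   coordinate from the second. *)
pose S := if v 0 0 == 0 then mx2 0 1 1 0 else mx2 1 0 (- (v 1 0 / v 0 0)) 1.
have Sdet : \det S != 0.
  by rewrite /S; case: ifP => _; rewrite det2E !mxE /= ?mulr1 ?mul0r ?sub0r ?oppr_eq0 ?subr0 ?oner_eq0.
have Su : S \in unitmx by rewrite unitmxE unitfE.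
pose M' t := S *m M t *m invmx S.
have M'det t : \det (M' t) != 0.
  by rewrite !det_mulmx det_inv !mulf_neq0 ?invr_eq0.
have M'op : one_parameter M'.
  move=> s t; have [k k0 e] := Mop s t; exists k => //.
  by rewrite /M' e -!mulmxA mulKmx // -scalemxAl -scalemxAr !mulmxA.
have M'MM : exists MM', rational_family M' MM'.
  have [d0 fam] := MMM; pose Sp (T : 'M[F]_2) : 'M[{poly F}]_2 := map_mx polyC T.
  have SpE T t : mxhorner (Sp T) t = T by apply/matrixP => i j; rewrite !mxE /horner_eval hornerC.
  exists (Sp S *m MM *m Sp (invmx S)); split.
    by rewrite !det_mulmx !det_map_mx !mulf_neq0 // polyC_eq0 ?det_inv ?invr_eq0.
  apply: cofinite_sub fam => t [k k0 e]; exists k => //.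
  by rewrite /M' e /mxhorner !map_mxM -!/(mxhorner _ _) !SpE -scalemxAr -scalemxAl.
have [MM' fam'] := M'MM.
have M'10 t : M' t 1 0 = 0.
  have v2 : (v 0 0 != 0) || (v 1 0 != 0).
    apply: contra_neqT v0; rewrite negb_or !negbK => /andP[/eqP e0 /eqP e1].
    by apply/colP => i; rewrite mxE; case: (ord2P i) => ->.
  have Sfix (w : 'cV[F]_2) : w 0 0 * v 1 0 = w 1 0 * v 0 0 -> (S *m w) 1 0 = 0.
    rewrite mulmx2E /S; case: eqP v2 => [-> /=|/eqP v00 _ e]; rewrite !mxE /=.
      by rewrite mulr0 => v1 /eqP; rewrite mulf_eq0 (negbTE v1) orbF => /eqP ->; ring.
    by apply: (mulIf v00); rewrite mulrDl mul1r -e mul0r; field.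
  have Sv0 : (S *m v) 0 0 != 0.
    rewrite mulmx2E /S; case: eqP v2 => [-> /=|/eqP v00 _]; rewrite !mxE /=.
      by rewrite mul0r add0r mul1r.
    by rewrite mul1r mul0r addr0.
  have := Sfix _ (fixv t); have -> : S *m (M t *m v) = M' t *m (S *m v).
    by rewrite /M' -!mulmxA mulKmx.
  rewrite mulmx2E (Sfix v (mulrC _ _)) mulr0 addr0 => /eqP.
  by rewrite mulf_eq0 (negbTE Sv0) orbF => /eqP.
have [b bE] := one_parameter_triangular M'det M'10 M'op fam'.
exists S, b; split=> // t; have [k k0 e] := bE t; exists k => //.
by rewrite scalemxAl -e mulmxKV.
Qed.

End Moebius.

(** * Rationality in the parameter of a morphism from the affine line *)
Section Geometry.
Context (C : numClosedFieldType).
Local Notation A1 := (affine C 1).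
Local Notation P2 := (proj C 2).

Definition apt (t : C) : A1 := const_mx t : 'rV[C]_1.

Lemma aptP (p : A1) : exists t, p = apt t.
Proof.
exists ((p : 'rV[C]_1) 0 0); apply/matrixP => i j; rewrite mxE.
by congr (fun_of_matrix p _ _); apply/val_inj; [case: i => [[]]|case: j => [[]]].
Qed.

Lemma meval_line n (P : {mpoly C[n]}) (u w : 'I_n -> C) (l : C) :
  (mmap (@polyC C) (fun i => (u i)%:P + (w i)%:P * 'X) P).[l] = P.@[fun i => u i + w i * l].
Proof.
rewrite mevalE /mmap horner_sum; apply: eq_bigr => m _; rewrite hornerM hornerC; congr (_ * _).
by rewrite /mmap1 horner_prod; apply: eq_bigr => i _; rewrite horner_exp !hornerE.
Qed.

Lemma meval_apt (P : {mpoly C[1]}) : exists p : {poly C}, forall t, P.@[(apt t : 'rV[C]_1) 0] = p.[t].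
Proof.
exists (mmap (@polyC C) (fun i => (0 : C)%:P + (1 : C)%:P * 'X) P) => t.
by rewrite meval_line; apply: meval_eq => i; rewrite add0r mul1r mxE.
Qed.

Lemma regular_apt U : open U -> regular U (fun p : A1 => (p : 'rV[C]_1) 0 0).
Proof.
move=> _ p _; exists setT, (fun p => (p : 'rV[C]_1) 0 0), (fun=> 1).
split=> //; [|exact: oner_neq0|by move=> q _ _ _; rewrite divr1].
by apply: (@affine_frac_ext _ _ 'X_0 1) => // q; rewrite ?mevalXU ?meval1.
Qed.

Lemma variety_A1 : variety A1.
Proof.
split.
  exists 1%N, (fun=> setT); split; last by rewrite bigcup_const //; exists ord0.
  move=> _; split; first exact: openT.
  exists 1%N, id; split; last by rewrite image_id; exact: closedT.
  split=> //.
  - move=> W _; split=> [oW|[O [oO ->]]]; last by rewrite setTI.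
    by exists W; rewrite setTI.
  - move=> W f oW _; split=> [rf p Wp|loc]; first by exists W, f.
    apply: regular_glue => // p /[dup] Wp /loc [O [g [oO Op rg E]]].
    exists (W `&` O), g; split=> //; first exact: openI.
      by apply: (regular_restrict oO) => //; exact: openI.
    by move=> q [Wq Oq]; exact: E.
rewrite -openC frac_openE => p /= np.
(* The complement of the diagonal is where the difference of the two coordinates, a tensor, does not
   vanish. *)
pose k (q : A1 * A1) := (q.1 : 'rV[C]_1) 0 0 - (q.2 : 'rV[C]_1) 0 0.
have kE : tensor (X := A1) (Y := A1) setT setT k.
  exists bool, (fun b (q : A1) => if b then (q : 'rV[C]_1) 0 0 else 1),
    (fun b (q : A1) => if b then 1 else - (q : 'rV[C]_1) 0 0); split.
  - by case; [exact/regular_apt/openT|exact/regular_cst/openT].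
  - case; first exact/regular_cst/openT.
    have -> : (fun q : A1 => - (q : 'rV[C]_1) 0 0) = (fun q : A1 => (fun=> -1) q * (q : 'rV[C]_1) 0 0).
      by apply/funext => q; rewrite mulN1r.
    by apply: regular_mul; [exact: openT|exact/regular_cst/openT|exact/regular_apt/openT].
  - by move=> q; rewrite big_bool /= mulr1 mul1r.
exists (setT `*` setT), k, k; split.
- by apply: ProdFrac => //; exact: openT.
- by [].
- rewrite subr_eq0; apply: contra_notN np => /eqP e.
  have [t tE] := aptP p.1; have [u uE] := aptP p.2.
  by move: e; rewrite tE uE !mxE => ->.
- by move=> q _ kq e; move: kq; rewrite /k e subrr eqxx.
Qed.

Lemma open_A1 (U : set A1) t : open U -> U (apt t) ->
  exists p : {poly C}, p.[t] != 0 /\ forall u, p.[u] != 0 -> U (apt u).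
Proof.
move=> oU Ut; have [B [h [k [[P Q] _ kt kU]]]] := (oU : frac_open U) _ Ut.
have [p pE] := meval_apt Q; exists p; split; first by rewrite -pE.
by move=> u pu; apply: kU => //; rewrite pE.
Qed.

(** Two nonempty open sets contain the nonzero loci of two nonzero polynomials, which share a
    natural number. *)
Lemma irreducible_A1 : irreducible A1.
Proof.
split; first by exists (apt 0).
move=> F G cF cG FG; apply: contrapT => /not_orP[/eqP nF /eqP nG].
have notT (H : set A1) : H != setT -> exists x, ~ H x.
  move=> /eqP nH; apply: contrapT => /forallNP h; apply: nH.
  by apply/seteqP; split=> // x _; apply: contrapT; exact: h.
have [x Fx] := notT _ nF; have [y Gy] := notT _ nG.
have [t xE] := aptP x; have [u yE] := aptP y; rewrite {}xE in Fx; rewrite {}yE in Gy.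
have [p [pt pF]] := open_A1 (closed_openC cF) Fx.
have [q [qu qG]] := open_A1 (closed_openC cG) Gy.
have p0 : p != 0 by apply: contra_neq pt => ->; rewrite horner0.
have q0 : q != 0 by apply: contra_neq qu => ->; rewrite horner0.
have [n [pn qn]] := cofinite_nat (cofinite_and (cofinite_root idfun p0) (cofinite_root idfun q0)).
have : (F `|` G) (apt n%:R) by rewrite FG.
by case; [apply: pF pn|apply: qG qn].
Qed.

Fact dim_pt (v : 'rV[C]_3) : \dim <[(if v == 0 then const_mx 1 else v)%R]>%VS = 1%N.
Proof.
rewrite dim_vline; case: ifPn => [_|->] //.
suff -> : (const_mx 1 : 'rV[C]_3) != 0 by [].
by apply/eqP => /rowP /(_ 0) /eqP; rewrite !mxE oner_eq0.
Qed.

(** The zero vector is sent to (1 : 1 : 1), so that [pt] is total. *)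
Definition pt (v : 'rV[C]_3) : P2 := ProjPoint (dim_pt v).

Lemma line_pt v : v != 0 -> line (pt v) = <[v]>%VS.
Proof. by rewrite /pt /= => /negbTE ->. Qed.

Lemma line_inj (p q : P2) : line p = line q -> p = q.
Proof.
case: p q => [l h] [l' h'] /= e; subst l'; congr ProjPoint; exact: Prop_irrelevance.
Qed.

Lemma vpick_line (p : P2) : vpick (line p) != 0.
Proof. by rewrite vpick0 -dimv_eq0; case: p => l /= ->. Qed.

Lemma line_vpick (p : P2) v : v != 0 -> v \in line p -> line p = <[v]>%VS.
Proof.
move=> v0 vl; apply/esym/eqP; rewrite eqEdim -memvE vl dim_vline v0 /=.
by case: p {vl} => l /= ->.
Qed.

Lemma ptP (p : P2) : exists2 v, v != 0 & p = pt v.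
Proof.
exists (vpick (line p)); first exact: vpick_line.
apply: line_inj; rewrite line_pt ?vpick_line //.
by apply: line_vpick; [exact: vpick_line|exact: memv_pick].
Qed.

Lemma hcoord_pt v (p : P2) : v != 0 -> line p = <[v]>%VS ->
  exists2 k, k != 0 & forall i, hcoord p i = k * v 0 i.
Proof.
move=> v0 pv; have := memv_pick (line p); rewrite {2}pv => /vlineP[k kE].
exists k; last by move=> i; rewrite /hcoord kE mxE.
by apply: contra_neq (vpick_line p) => k0; rewrite kE k0 scale0r.
Qed.

Lemma meval_homog d (P : {mpoly C[3]}) (f g : 'I_3 -> C) k : P \is d.-homog ->
  (forall i, f i = k * g i) -> P.@[f] = k ^+ d * P.@[g].
Proof.
move=> hP fg; rewrite !mevalE mulr_sumr; apply: eq_big_seq => m mP.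
rewrite mulrCA; congr (_ * _); rewrite -(dhomog_mf hP mP) /= mdegE -prodrXr -big_split /=.
by apply: eq_bigr => i _; rewrite fg exprMn.
Qed.
(** Polynomials in [t] over C[X_0, X_1, X_2]. No homogeneity is imposed: functions on A^1 x P^2 are
    studied through their pullback to A^1 x (C^3 - 0). *)
Definition ev (H : {poly {mpoly C[3]}}) t (v : 'rV[C]_3) := (H.[t%:MP]).@[v 0].

Lemma evD H H' t v : ev (H + H') t v = ev H t v + ev H' t v.
Proof. by rewrite /ev hornerD mevalD. Qed.

Lemma evM H H' t v : ev (H * H') t v = ev H t v * ev H' t v.
Proof. by rewrite /ev hornerM mevalM. Qed.

Lemma ev_poly (p : {poly C}) t v : ev (map_poly (@mpolyC 3 C) p) t v = p.[t].
Proof. by rewrite /ev horner_map mevalC. Qed.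

Lemma ev_mpoly P t v : ev P%:P t v = P.@[v 0].
Proof. by rewrite /ev hornerC. Qed.

(* [near t0 v0 S]: S holds on a basic neighbourhood of (t0, v0) in A^1 x (C^3 - 0). *)
Definition near t0 v0 (S : C -> 'rV[C]_3 -> Prop) := exists N,
  ev N t0 v0 != 0 /\ forall t v, v != 0 -> ev N t v != 0 -> S t v.

Definition rat_near t0 v0 (phi : C -> 'rV[C]_3 -> C) := exists H N,
  near t0 v0 (fun t v => ev N t v != 0 /\ phi t v = ev H t v / ev N t v).

(** * Regular functions as local quotients of polynomials *)

Section Near.
Context (t0 : C) (v0 : 'rV[C]_3) (v0_neq0 : v0 != 0).
Local Notation near := (near t0 v0).
Local Notation rat_near := (rat_near t0 v0).

Lemma near_sub (S T : C -> 'rV[C]_3 -> Prop) :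
  (forall t v, v != 0 -> S t v -> T t v) -> near S -> near T.
Proof. by move=> h [N [N0 NS]]; exists N; split=> // t v vn /NS S1; apply: h => //; exact: S1. Qed.

Lemma near_and (S T : C -> 'rV[C]_3 -> Prop) : near S -> near T -> near (fun t v => S t v /\ T t v).
Proof.
move=> [N [N0 NS]] [M [M0 MT]]; exists (N * M); rewrite evM mulf_neq0 //; split=> // t v vn.
by rewrite evM mulf_eq0 negb_or => /andP[Nt Mt]; split; [exact: NS|exact: MT].
Qed.

Lemma near_sub2 (S T W : C -> 'rV[C]_3 -> Prop) :
  (forall t v, v != 0 -> S t v -> T t v -> W t v) -> near S -> near T -> near W.
Proof. by move=> h nS nT; apply: near_sub (near_and nS nT) => t v vn []; exact: h. Qed.

Lemma near_ev N : ev N t0 v0 != 0 -> near (fun t v => ev N t v != 0).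
Proof. by move=> N0; exists N. Qed.

Lemma near_here S : near S -> S t0 v0.
Proof. by move=> [N [N0 NS]]; exact: NS. Qed.

Lemma near_forall n (S : 'I_n -> C -> 'rV[C]_3 -> Prop) : (forall i, near (S i)) ->
  near (fun t v => forall i, S i t v).
Proof.
elim: n S => [|n IH] S h.
  by exists 1; rewrite /ev hornerC meval1 oner_neq0; split=> // ? ? _ _ [].
apply: near_sub2 (h ord0) (IH (fun i => S (lift ord0 i)) (fun i => h _)) => t v _ S0 Sl i.
by case: (unliftP ord0 i) => [j ->|->].
Qed.

Lemma rat_ext (phi psi : C -> 'rV[C]_3 -> C) :
  near (fun t v => psi t v = phi t v) -> rat_near phi -> rat_near psi.
Proof.
move=> e [H [N h]]; exists H, N; apply: near_sub2 e h => t v _ -> [N0 ->].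
by split.
Qed.

Lemma rat_ev H : rat_near (ev H).
Proof.
exists H, 1; exists 1; rewrite {1}/ev hornerC meval1 oner_neq0; split=> // t v _ _.
by rewrite /ev [in X in _ / X]hornerC hornerC meval1 divr1 oner_neq0.
Qed.

Lemma rat_add phi psi : rat_near phi -> rat_near psi -> rat_near (fun t v => phi t v + psi t v).
Proof.
move=> [H [N h]] [H' [N' h']]; exists (H * N' + H' * N), (N * N').
apply: near_sub2 h h' => t v _ [n0 ->] [n0' ->].
by rewrite evD !evM mulf_neq0 // addf_div.
Qed.

Lemma rat_mul phi psi : rat_near phi -> rat_near psi -> rat_near (fun t v => phi t v * psi t v).
Proof.
move=> [H [N h]] [H' [N' h']]; exists (H * H'), (N * N').
apply: near_sub2 h h' => t v _ [n0 ->] [n0' ->].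
by rewrite !evM mulf_neq0 // mulf_div.
Qed.

Lemma rat_neq0 phi : rat_near phi -> phi t0 v0 != 0 -> near (fun t v => phi t v != 0).
Proof.
move=> [H [N h]]; have [N0 ->] := near_here h.
rewrite mulf_eq0 negb_or => /andP[/near_ev nH _].
by apply: near_sub2 h nH => t v _ [Nt ->] Ht; rewrite mulf_neq0 ?invr_eq0.
Qed.

Lemma rat_div phi psi : rat_near phi -> rat_near psi -> psi t0 v0 != 0 ->
  rat_near (fun t v => phi t v / psi t v).
Proof.
move=> rphi rpsi psi0; apply: rat_mul => //.
have := rat_neq0 rpsi psi0; have [H [N h]] := rpsi => h'; exists N, H.
apply: near_sub2 h h' => t v _ [N0 ->].
by rewrite mulf_eq0 negb_or => /andP[H0 _]; rewrite invf_div.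
Qed.

Lemma near_A1 (U : set A1) : open U -> U (apt t0) -> near (fun t _ => U (apt t)).
Proof.
move=> oU Ut; have [p [pt0 pU]] := open_A1 oU Ut.
by exists (map_poly (@mpolyC 3 C) p); rewrite ev_poly; split=> // t v _; rewrite ev_poly; exact: pU.
Qed.

Lemma rat_A1 (U : set A1) f : open U -> regular U f -> U (apt t0) -> rat_near (fun t _ => f (apt t)).
Proof.
move=> oU rf Ut; have [B [h [k [[P Q] _ kt kU]]]] := (rf : frac_regular U f) _ Ut.
have [p pE] := meval_apt P; have [q qE] := meval_apt Q; rewrite qE in kt.
exists (map_poly (@mpolyC 3 C) p), (map_poly (@mpolyC 3 C) q).
have := @near_ev (map_poly (@mpolyC 3 C) q); rewrite ev_poly => /(_ kt) nq.
apply: near_sub2 (near_A1 oU Ut) nq => t v _ Ut'; rewrite !ev_poly => qt; split=> //.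
by rewrite kU ?pE ?qE.
Qed.

Lemma hcoord_ptE v : v != 0 -> exists2 k, k != 0 & forall i, hcoord (pt v) i = k * v 0 i.
Proof. by move=> vn; apply: hcoord_pt => //; exact: line_pt. Qed.

Lemma proj_neq0 d (Q : {mpoly C[3]}) v : Q \is d.-homog -> v != 0 ->
  (Q.@[hcoord (pt v)] != 0) = (Q.@[v 0] != 0).
Proof.
move=> hQ vn; have [k k0 kE] := hcoord_ptE vn.
by rewrite (meval_homog hQ kE) mulf_eq0 expf_eq0 (negbTE k0) andbF.
Qed.

Lemma near_P2 (V : set P2) : open V -> V (pt v0) -> near (fun _ v => V (pt v)).
Proof.
move=> oV Vv; have [B [h [k [[d P Q hP hQ] _ kv kV]]]] := (oV : frac_open V) _ Vv.
exists Q%:P; rewrite ev_mpoly -(proj_neq0 hQ) //; split=> // t v vn.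
by rewrite ev_mpoly -(proj_neq0 hQ) // => Qv; exact: kV.
Qed.

Lemma rat_P2 (V : set P2) f : open V -> regular V f -> V (pt v0) -> rat_near (fun _ v => f (pt v)).
Proof.
move=> oV rf Vv; have [B [h [k [[d P Q hP hQ] _ kv kV]]]] := (rf : frac_regular V f) _ Vv.
rewrite (proj_neq0 hQ) // -(ev_mpoly _ t0) in kv; exists P%:P, Q%:P.
apply: near_sub2 (near_P2 oV Vv) (near_ev kv) => t v vn Vt; rewrite !ev_mpoly => Qv; split=> //.
rewrite kV ?(proj_neq0 hQ) //; have [c c0 cE] := hcoord_ptE vn.
by rewrite (meval_homog hP cE) (meval_homog hQ cE) -mulf_div divff ?mul1r ?expf_neq0.
Qed.

Lemma rat_tensor (U : set A1) (V : set P2) h : open U -> open V -> tensor (X := A1) (Y := P2) U V h ->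
  U (apt t0) -> V (pt v0) -> rat_near (fun t v => h (apt t, pt v)).
Proof.
move=> oU oV [I [f [g [rf rg E]]]] Ut Vv.
suff [H [N e]] : rat_near (fun t v => \sum_i f i (apt t) * g i (pt v)).
  by exists H, N; apply: near_sub e => t v _; rewrite E.
elim: (index_enum I) => [|i r IH].
  apply: rat_ext (rat_ev 0); exists 1; rewrite {1}/ev hornerC meval1 oner_neq0; split=> // t v _ _.
  by rewrite big_nil /ev horner0 meval0.
have [H [N e]] := rat_add (rat_mul (rat_A1 oU (rf i) Ut) (rat_P2 oV (rg i) Vv)) IH.
by exists H, N; apply: near_sub e => t v _; rewrite big_cons.
Qed.

Lemma near_prod (O : set (prod_space A1 P2)) : open O -> O (apt t0, pt v0) ->
  near (fun t v => O (apt t, pt v)).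
Proof.
move=> oO Op; have [B [h [k [F Bp kp kO]]]] := (oO : frac_open O) _ Op.
case: F Bp kp kO => U V {}h {}k oU oV _ tk [/= Ut Vv] kp kO.
apply: near_sub2 (near_and (near_A1 oU Ut) (near_P2 oV Vv)) (rat_neq0 (rat_tensor oU oV tk Ut Vv) kp).
by move=> t v _ [Ut' Vv'] kt; apply: kO.
Qed.

(** A regular function on the product is locally a quotient of tensors, and tensors are rational
    near the point by [rat_tensor]. *)
Lemma rat_prod (O : set (prod_space A1 P2)) f : open O -> regular O f -> O (apt t0, pt v0) ->
  rat_near (fun t v => f (apt t, pt v)).
Proof.
move=> oO rf Op; have [B [h [k [F Bp kp kO]]]] := (rf : frac_regular O f) _ Op.
case: F Bp kp kO => U V {}h {}k oU oV th tk [/= Ut Vv] kp kO.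
have rk := rat_tensor oU oV tk Ut Vv.
apply: rat_ext (rat_div (rat_tensor oU oV th Ut Vv) rk kp).
apply: near_sub2 (near_and (near_A1 oU Ut) (near_P2 oV Vv))
  (near_and (near_prod oO Op) (rat_neq0 rk kp)).
by move=> t v _ [Ut' Vv'] [Op' kt]; apply: kO.
Qed.

End Near.

(** * The affine chart, and rationality of a morphism to Bir *)

Definition vec (x y : C) : 'rV[C]_3 := \row_i [:: x; y; 1]`_i.

Lemma vec_neq0 x y : vec x y != 0.
Proof. by apply/eqP => /rowP /(_ 2) /eqP; rewrite !mxE /= oner_eq0. Qed.

Lemma chart_eval (p : {mpoly C[3]}) x y : (chart p).[x%:P].[y] = p.@[vec x y 0].
Proof.
rewrite mevalE /chart /mmap !horner_sum; apply: eq_bigr => m _.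
rewrite !hornerM /cst2 !hornerC; congr (_ * _).
rewrite /mmap1 !horner_prod; apply: eq_bigr => i _; rewrite !horner_exp mxE; congr (_ ^+ _).
case: (ord3P i) => ->; rewrite (tnth_nth 0) /=.
- by rewrite hornerX hornerC.
- by rewrite hornerC hornerX.
- by rewrite -polyC1 hornerC -polyC1 hornerC.
Qed.

Lemma chart_ev H t x y : (map_poly (@chart C) H).[t%:P%:P].[x%:P].[y] = ev H t (vec x y).
Proof.
rewrite /ev -chart_eval -horner_map /=.
by have -> : chart t%:MP = t%:P%:P by rewrite /chart mmapC.
Qed.

(** A representative of the point is moved along the direction (0, 0, 1): a general translate stays
    in the open set and has nonzero last coordinate. *)
Lemma open_meets_chart t0 (U : set (prod_space A1 P2)) p : open U -> U (apt t0, p) ->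
  exists x y, U (apt t0, pt (vec x y)).
Proof.
move=> oU; have [v0 v0n ->] := ptP p => /(near_prod v0n oU) [N [N0 NU]].
pose w (i : 'I_3) : C := (i == 2)%:R.
pose q := mmap (@polyC C) (fun i => (v0 0 i)%:P + (w i)%:P * 'X) N.[t0%:MP].
have q0 : q != 0.
  apply: contra_neq N0 => q0; transitivity N.[t0%:MP].@[fun i => v0 0 i + w i * 0].
    by apply: meval_eq => i; rewrite mulr0 addr0.
  by rewrite -meval_line -/q q0 horner0.
have [n [qn n2]] := cofinite_nat (cofinite_and (cofinite_root idfun q0) (cofinite_neq (- v0 0 2))).
pose v1 : 'rV[C]_3 := \row_i (v0 0 i + w i * n%:R).
have v12 : v1 0 2 != 0 by rewrite mxE /w eqxx mul1r -[v0 0 2]opprK addrC subr_eq0.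
have v1n : v1 != 0 by apply: contra_neq v12 => ->; rewrite mxE.
exists (v1 0 0 / v1 0 2), (v1 0 1 / v1 0 2).
have -> : pt (vec (v1 0 0 / v1 0 2) (v1 0 1 / v1 0 2)) = pt v1.
  apply: line_inj; rewrite line_pt ?vec_neq0 //; apply/esym/line_vpick; rewrite ?vec_neq0 //.
  rewrite line_pt //; apply/vlineP; exists (v1 0 2)^-1; apply/rowP => i; rewrite [LHS]mxE [RHS]mxE.
  by case: (ord3P i) => -> /=; [exact: mulrC|exact: mulrC|rewrite mulVf].
apply: NU => //; rewrite /ev; move: qn; rewrite meval_line.
by rewrite (@meval_eq _ _ (v1 0) (fun i => v0 0 i + w i * n%:R)) // => i; rewrite mxE.
Qed.

Lemma ratio_neq0 (A : idomainType) (a b c d : A) : a != 0 -> b != 0 -> a * b = c * d -> c != 0.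
Proof.
by move=> a0 b0 e; have := mulf_neq0 a0 b0; rewrite e mulf_eq0 negb_or => /andP[].
Qed.

(** Passes from quotients by an auxiliary component [d] to quotients by [a']. *)
Lemma ratio_elim (A : comNzRingType) (a b c a' b' c' d : A) : a * b = c * d -> a' * b' = c' * d ->
  a * (b * c') = c * b' * a'.
Proof. by move=> e e'; rewrite mulrA e -mulrA [d * _]mulrC -e'; ring. Qed.

(** Near a point of [U], ratios of homogeneous coordinates of the image are regular functions pulled
    back along [f], hence quotients of polynomials by [rat_prod]. On each slice they agree with the
    ratios of components of the triple of [phi]. *)
Lemma bir_morphism_rational (phi : A1 -> Bir C) : bir_morphism phi ->
  exists P0 Q0 P1 Q1 : {poly {poly {poly C}}}, cofinite (fun t =>
    let F i := chart (tnth (fwd (repr (phi (apt t)))) i) in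
    [/\ Q0.[t%:P%:P] != 0, Q1.[t%:P%:P] != 0, F 0 * Q0.[t%:P%:P] = P0.[t%:P%:P] * F 2 &
        F 1 * Q1.[t%:P%:P] = P1.[t%:P%:P] * F 2]).
Proof.
move=> [U [V [f [g [[oU oV mf _ _] _ UT _ fE]]]]].
have [t0 [x0 [y0 Up]]] : exists t0 x0 y0, U (apt t0, pt (vec x0 y0)).
  have [[p w] Upw _] : [set p.1 | p in U] (apt 0) by rewrite UT.
  by have [t pE] := aptP p; exists t; apply: open_meets_chart oU _; rewrite -pE; exact: Upw.
set p0 := (apt t0, _) in Up; have v0n := vec_neq0 x0 y0.
(* The image point may lie on the line z = 0, so ratios are first taken with respect to some nonzero
   coordinate [j]. *)
have [j fj] : exists j, hcoord (f p0).2 j != 0.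
  apply: contrapT => /forallNP h; have /eqP := vpick_line (f p0).2; apply.
  by apply/rowP => i; rewrite mxE; have /negP/negPn/eqP := h i.
pose D : set P2 := [set w | hcoord w j != 0].
have oD : open D.
  rewrite frac_openE => w Dw; exists setT, (fun w => hcoord w j), (fun w => hcoord w j).
  by split=> //; apply: (@proj_frac_ext _ _ 1 'X_j 'X_j) => [|||q|q] //;
    rewrite ?mevalXU // dhomogX /= mdeg1.
pose W : set (prod_space A1 P2) := setT `*` D.
have oW : open W.
  rewrite frac_openE => q [_ Dq]; exists (setT `*` D), (fun=> 1), (fun=> 1); split=> //.
  - by apply: ProdFrac => //; do ?[exact: openT|apply: tensor_cst].
  - exact: oner_neq0.
pose r i (q : prod_space A1 P2) := hcoord q.2 i / hcoord q.2 j.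
have rW i : regular W (r i).
  move=> q Wq; exists W, (r i), (fun=> 1); split=> //; last by move=> *; rewrite divr1.
  - apply: ProdFrac => //; try exact: openT; last by apply: tensor_cst => //; exact: openT.
    exists unit, (fun _ _ => 1), (fun _ w => hcoord w i / hcoord w j); split.
    + by move=> _; exact/regular_cst/openT.
    + move=> _ w Dw; exists setT, (fun w => hcoord w i), (fun w => hcoord w j); split=> //.
      by apply: (@proj_frac_ext _ _ 1 'X_i 'X_j) => [|||c|c] //;
        rewrite ?mevalXU // dhomogX /= mdeg1.
    + by move=> c; rewrite big_const card_unit /= addr0 mul1r.
  - exact: oner_neq0.
have [oO _] := mf W oW.
have rO i := (mf W oW).2 _ (rW i).
have Op : (U `&` f @^-1` W) p0 by split.
have [H [N HN]] : exists H N : 'I_3 -> {poly {mpoly C[3]}}, near t0 (vec x0 y0) (fun t v =>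
    (U `&` f @^-1` W) (apt t, pt v) /\
    forall i, ev (N i) t v != 0 /\ r i (f (apt t, pt v)) = ev (H i) t v / ev (N i) t v).
  have rr i := rat_prod v0n oO (rO i) Op.
  pose HH i := projT1 (cid (rr i)); pose NN i := projT1 (cid (projT2 (cid (rr i)))).
  exists HH, NN; apply: near_and (near_prod v0n oO Op) _; apply: near_forall => i.
  exact: (projT2 (cid (projT2 (cid (rr i))))).
have [M [M0 MHN]] := HN.
pose h i := map_poly (@chart C) (H i); pose n i := map_poly (@chart C) (N i).
exists (h 0 * n 2), (n 0 * h 2), (h 1 * n 2), (n 1 * h 2).
(* Restricting [M] to the point (x0, y0) shows that only finitely many [t] make it vanish
   identically on the slice. *)
pose m := map_poly (meval (vec x0 y0 0)) M.
have mE t : m.[t] = ev M t (vec x0 y0).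
  by rewrite /ev -horner_map /= mevalC.
have m0 : m != 0 by apply: contra_neq M0 => m0; rewrite -mE m0 horner0.
apply: cofinite_sub (cofinite_root idfun m0) => t mt /=.
set r0 := repr (phi (apt t)); set F := fwd r0.
have [d hF] := fwd_homog r0; rewrite -/F in hF.
have Frep : represents F (phi (apt t)).
  by split; [exists d|exact: fwd_neq0|exact: proportional_refl].
pose Mt := (map_poly (@chart C) M).[t%:P%:P].
have Mt0 : Mt != 0.
  by apply: contra_neq mt => Mt0; rewrite mE -chart_ev -/Mt Mt0 !horner0.
have nt i : (n i).[t%:P%:P] != 0.
  have [x [y Mxy]] := poly2_neq0 Mt0; rewrite chart_ev in Mxy.
  have [_ /(_ i)[ni _]] := MHN _ _ (vec_neq0 x y) Mxy.
  by apply: contra_neq ni => n0; rewrite -chart_ev -/(n i) n0 !horner0.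
have FE i : chart (tnth F i) * (n i).[t%:P%:P] = (h i).[t%:P%:P] * chart (tnth F j).
  apply: (poly2_eq Mt0) => x y Mxy; rewrite [(_ * _).[_]]hornerM [X in _ = X.[_]]hornerM.
  rewrite 2!(hornerM _ _ y) !chart_ev !chart_eval; rewrite chart_ev in Mxy.
  have vn := vec_neq0 x y.
  have [[Uxy [_ /= fjn]] /(_ i)[ni rE]] := MHN _ _ vn Mxy.
  have [k k0 kE] := hcoord_ptE vn.
  have tE l : triple_at F (pt (vec x y)) 0 l = k ^+ d * (tnth F l).@[vec x y 0].
    by rewrite mxE (meval_homog (hF l) kE).
  (* At a common zero of the components both sides are 0; elsewhere [fE] gives the image point. *)
  have [t00|tn0] := eqVneq (triple_at F (pt (vec x y))) 0.
    have z l : (tnth F l).@[vec x y 0] = 0.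
      by apply: (mulfI (expf_neq0 d k0)); rewrite -tE t00 mxE mulr0.
    by rewrite !z mul0r mulr0.
  have [c c0 cE] := hcoord_pt tn0 (fE _ _ _ Uxy Frep tn0).
  move: rE fjn; rewrite /D /r /mkset !cE !tE => rE fjn.
  have Fj0 : (tnth F j).@[vec x y 0] != 0.
    by apply: contra_neq fjn => ->; rewrite !mulr0.
  have {}rE : (tnth F i).@[vec x y 0] / (tnth F j).@[vec x y 0] =
      ev (H i) t (vec x y) / ev (N i) t (vec x y).
    by rewrite -rE; field; rewrite Fj0 c0 expf_neq0.
  by move/eqP: rE; rewrite eqr_div // => /eqP.
have F20 : chart (tnth F 2) != 0.
  by have := fwd2_neq0 r0; apply: contra_neq => /(chart_inj (hF 2)).
have h20 : (h 2).[t%:P%:P] != 0 by apply: ratio_neq0 F20 (nt 2) (FE 2).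
have hM (a b : {poly {poly {poly C}}}) : (a * b).[t%:P%:P] = a.[t%:P%:P] * b.[t%:P%:P].
  exact: hornerM.
split.
- by rewrite hM; exact: mulf_neq0.
- by rewrite hM; exact: mulf_neq0.
- by rewrite !hM; exact: ratio_elim (FE 0) (FE 2).
- by rewrite !hM; exact: ratio_elim (FE 1) (FE 2).
Qed.

End Geometry.

(** * Moebius maps of rational function fields *)
Section MoebiusMap.
Context (L : fieldType).
Implicit Types (A B : 'M[L]_2) (z : L).

Definition mob A z := (A 0 0 * z + A 0 1) / (A 1 0 * z + A 1 1).

Lemma mobZ k A z : k != 0 -> mob (k *: A) z = mob A z.
Proof. by move=> k0; rewrite /mob !mxE -!mulrA -!mulrDr -mulf_div divff ?mul1r. Qed.

(** If the outer denominator vanishes, both sides are 0 by the convention on the inverse of 0. *)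
Lemma mobM A B z : B 1 0 * z + B 1 1 != 0 -> mob (A *m B) z = mob A (mob B z).
Proof.
move=> d0; rewrite /mob !mulmx2E; set d := B 1 0 * z + _ in d0 *; set n := B 0 0 * z + _.
have E (a b : L) : a * (n / d) + b = (a * n + b * d) / d by field.
rewrite !E invf_div mulf_div [d * _]mulrC -mulf_div divff // mulr1 /n /d.
by congr (_ / _); ring.
Qed.

Lemma mob1 z : mob 1%:M z = z.
Proof. by rewrite /mob !mxE /= mul1r mul0r addr0 add0r divr1. Qed.

Lemma mob_translation b z : mob (mx2 1 b 0 1) z = z + b.
Proof. by rewrite /mob !mxE /= mul1r mul0r add0r divr1. Qed.

End MoebiusMap.

Lemma rmorph_mob (L L' : fieldType) (f : {rmorphism L -> L'}) (A : 'M[L]_2) z :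
  f (mob A z) = mob (map_mx f A) (f z).
Proof. by rewrite /mob fmorph_div !rmorphD !rmorphM !mxE. Qed.

(* L is F(X) along iota. *)
Definition is_fraction (F L : fieldType) (iota : {rmorphism {poly F} -> L}) :=
  injective iota /\ forall z, exists p q, q != 0 /\ z = iota p / iota q.

Section RationalFunctions.
Context (F L : fieldType) (iota : {rmorphism {poly F} -> L}) (iotaP : is_fraction iota).
Local Notation j := (iota \o @polyC F).
Local Notation x := (iota 'X).

Lemma iota_neq0 p : p != 0 -> iota p != 0.
Proof. by apply: contra_neq; rewrite -[RHS](rmorph0 iota); exact: iotaP.1. Qed.

Lemma iota_linear a b : iota (a *: 'X + b%:P) = j a * x + j b.
Proof. by rewrite -mul_polyC rmorphD rmorphM. Qed.

Lemma mob_den_neq0 (A : 'M[F]_2) : \det A != 0 -> j (A 1 0) * x + j (A 1 1) != 0.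
Proof.
move=> dA; rewrite -iota_linear; apply: iota_neq0; apply: contra_neq dA => /polyP h.
have := h 0%N; have := h 1%N; rewrite !coefD !coefZ !coefX !coefC /= mulr1 mulr0 addr0 add0r det2E.
by rewrite ?coef0 => -> ->; rewrite !mulr0 subrr.
Qed.

(** By injectivity of [iota], the cross-multiplied equality is one of polynomials, to which
    [projeq_graph] applies. *)
Lemma mob_inj (A B : 'M[F]_2) : \det A != 0 -> \det B != 0 ->
  mob (map_mx j A) x = mob (map_mx j B) x -> projeq A B.
Proof.
move=> dA dB; rewrite /mob !mxE => /eqP; rewrite eqr_div ?mob_den_neq0 // => /eqP e.
apply: projeq_graph => //; apply: iotaP.1; rewrite [LHS]rmorphM [RHS]rmorphM !iota_linear.
by rewrite e mulrC.
Qed.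

Lemma mobM_x (A : 'M[L]_2) (B : 'M[F]_2) : \det B != 0 ->
  mob (A *m map_mx j B) x = mob A (mob (map_mx j B) x).
Proof. by move=> dB; apply: mobM; rewrite !mxE; exact: mob_den_neq0. Qed.

Lemma fraction_ext (L' : fieldType) (f g : {rmorphism L -> L'}) :
  (forall a, f (j a) = g (j a)) -> f x = g x -> f =1 g.
Proof.
move=> fg fgx; have E p : f (iota p) = g (iota p).
  elim/poly_ind: p => [|p c IH]; first by rewrite !rmorph0.
  by rewrite !rmorphD !rmorphM IH fgx; congr (_ + _); exact: fg.
by move=> z; have [p [q [_ ->]]] := iotaP.2 z; rewrite !fmorph_div !E.
Qed.

Lemma fraction_lift (L' : fieldType) (h : {rmorphism {poly F} -> L'}) :
  (forall p, h p = 0 -> p = 0) -> exists f : {rmorphism L -> L'}, forall p, f (iota p) = h p.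
Proof.
move=> h_inj; have h0 p : p != 0 -> h p != 0 by apply: contra_neq; exact: h_inj.
pose num z := projT1 (cid (iotaP.2 z)).
pose den z := projT1 (cid (projT2 (cid (iotaP.2 z)))).
have ndP z : den z != 0 /\ z = iota (num z) / iota (den z) := projT2 (cid (projT2 (cid (iotaP.2 z)))).
pose f z := h (num z) / h (den z).
have fE p q z : q != 0 -> z = iota p / iota q -> f z = h p / h q.
  move=> q0 e; have [d0 e'] := ndP z; apply/eqP; rewrite /f eqr_div ?h0 // -!rmorphM; apply/eqP.
  congr (h _); apply: iotaP.1; rewrite !rmorphM; apply/eqP.
  by rewrite -eqr_div ?iota_neq0 // -e -e'.
have [g gf] : exists g : {rmorphism L -> L'}, g =1 f.
  apply: rmorphismP; last split.
  - move=> a b; have [a0 ea] := ndP a; have [b0 eb] := ndP b.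
    rewrite (fE _ _ _ a0 ea) (fE _ _ _ b0 eb).
    rewrite (fE (num a * den b - num b * den a) (den a * den b)) ?mulf_neq0 //.
      by rewrite rmorphB !rmorphM; field; rewrite !h0.
    transitivity (iota (num a) / iota (den a) - iota (num b) / iota (den b)).
      by rewrite -ea -eb.
    by rewrite rmorphB !rmorphM; field; rewrite !iota_neq0.
  - by rewrite (fE 1 1) ?rmorph1 ?divr1 ?oner_eq0.
  - move=> a b; have [a0 ea] := ndP a; have [b0 eb] := ndP b.
    rewrite (fE _ _ _ a0 ea) (fE _ _ _ b0 eb).
    rewrite (fE (num a * num b) (den a * den b)) ?mulf_neq0 //.
      by rewrite !rmorphM mulf_div.
    transitivity (iota (num a) / iota (den a) * (iota (num b) / iota (den b))).
      by rewrite -ea -eb.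
    by rewrite !rmorphM mulf_div.
exists g => p; rewrite gf (fE p 1) ?oner_eq0 ?rmorph1 ?divr1 //.
Qed.

(** Clearing denominators gives [G], the sum of the p_i n^i d^(N-i) with N the degree of [p]. If [d]
    is constant, [p] has been composed with a polynomial of degree 1; otherwise at the root of [d]
    only the term of index N survives, and [n] is nonzero there since [\det A] is. *)
Lemma mob_transcendental (A : 'M[F]_2) (p : {poly F}) : \det A != 0 ->
  (map_poly j p).[mob (map_mx j A) x] = 0 -> p = 0.
Proof.
move=> dA; rewrite /mob !mxE -!iota_linear; set n := _ + _; set d := _ + _ => pz.
have d0 : iota d != 0 by rewrite iota_linear; exact: mob_den_neq0.
apply/eqP; apply/negPn/negP => p0; have sp : (0 < size p)%N by rewrite size_poly_gt0.
pose G := \sum_(i < size p) p`_i *: (n ^+ i * d ^+ ((size p).-1 - i)).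
have G0 : G = 0.
  apply: iotaP.1; rewrite rmorph0 -[RHS](mulr0 (iota d ^+ (size p).-1)) -pz.
  rewrite (@horner_coef_wide _ (size p)) ?size_map_poly // mulr_sumr rmorph_sum.
  apply: eq_bigr => i _; rewrite coef_map -mul_polyC !rmorphM [RHS]mulrCA; congr (_ * _).
  rewrite !rmorphXn expr_div_n.
  have E : (size p).-1 = ((size p).-1 - i + i)%N by rewrite subnK // -ltnS prednK.
  by rewrite [X in _ = iota d ^+ X * _]E exprD; field; rewrite expf_neq0.
have [c0|c0] := eqVneq (A 1 0) 0.
  have dE : d = (A 1 1)%:P by rewrite /d c0 scale0r add0r.
  move: dA; rewrite det2E c0 mulr0 subr0 mulf_eq0 negb_or => /andP[a0 e0].
  pose q := (A 0 0 / A 1 1) *: 'X + (A 0 1 / A 1 1)%:P.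
  have sq : size q = 2%N.
    rewrite /q size_polyDl size_scale ?mulf_neq0 ?invr_eq0 ?size_polyX //.
    by rewrite ltnS size_polyC leq_b1.
  have /eqP : iota (p \Po q) = 0.
    rewrite -pz comp_polyE (@horner_coef_wide _ (size p)) ?size_map_poly // rmorph_sum.
    apply: eq_bigr => i _; rewrite coef_map -mul_polyC rmorphM rmorphXn; congr (_ * _ ^+ _).
    apply: (mulIf d0); rewrite divfK // -rmorphM dE; congr (iota _).
    by rewrite /q /n -!mul_polyC mulrDl mulrAC -!polyCM !divfK.
  by rewrite -[0](rmorph0 iota) (inj_eq iotaP.1) comp_poly2_eq0 // (negbTE p0).
pose r := - (A 1 1) / A 1 0.
have dr : d.[r] = 0 by rewrite /d /r !(hornerD, hornerZ, hornerX, hornerC); field.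
have nr : n.[r] != 0.
  have -> : n.[r] = - (\det A / A 1 0) 
    by rewrite det2E /n /r !(hornerD, hornerZ, hornerX, hornerC); field.
  by rewrite oppr_eq0 mulf_neq0 ?invr_eq0.
have /eqP := congr1 (horner^~ r) G0; rewrite horner0 /G horner_sum.
have last : ((size p).-1 < size p)%N by rewrite prednK.
rewrite (bigD1 (Ordinal last)) //= subnn expr0 mulr1 big1 ?addr0 => [|i ni].
  rewrite hornerZ horner_exp mulf_eq0 expf_eq0 (negbTE nr) andbF orbF -lead_coefE.
  by rewrite lead_coef_eq0 (negbTE p0).
have lt_i : (i < (size p).-1)%N by rewrite ltn_neqAle -[(i <= _)%N]ltnS prednK // ltn_ord andbT.
by rewrite hornerZ hornerM !horner_exp dr expr0n subn_eq0 leqNgt lt_i !mulr0.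
Qed.

(** By transcendence, substituting the Moebius transform for x is injective on polynomials, so it
    extends to fractions. *)
Lemma mob_lift (phi : {rmorphism F -> F}) (A : 'M[F]_2) : \det A != 0 ->
  exists f : {rmorphism L -> L}, (forall a, f (j a) = j (phi a)) /\ f x = mob (map_mx j A) x.
Proof.
move=> dA; pose z := mob (map_mx j A) x.
pose h (p : {poly F}) := (map_poly j (map_poly phi p)).[z].
have hA : zmod_morphism h by move=> p q; rewrite /h !rmorphB hornerD hornerN.
have hM : monoid_morphism h by split=> [|p q]; rewrite /h ?rmorph1 ?hornerC // !rmorphM hornerM.
pose mA := GRing.isZmodMorphism.Build _ _ h hA.
pose mM := GRing.isMonoidMorphism.Build _ _ h hM.
pose hR : {rmorphism {poly F} -> L} := HB.pack h mA mM.
have [p /(mob_transcendental dA) /eqP|f fE] := @fraction_lift _ hR.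
  by rewrite map_poly_eq0 => /eqP.
exists f; split=> [a|]; first by rewrite fE /= /h !map_polyC hornerC.
by rewrite fE /= /h !map_polyX hornerX.
Qed.

End RationalFunctions.

(** * Normal form of a flow on C(x,y) *)
Section JonquieresFlow.
Context (C : numFieldType) (F L : fieldType).
Context (iota1 : {rmorphism {poly C} -> F}) (iota1P : is_fraction iota1).
Context (iota2 : {rmorphism {poly F} -> L}) (iota2P : is_fraction iota2).
Local Notation c := (iota1 \o @polyC C).
Local Notation j := (iota2 \o @polyC F).
Local Notation y := (iota1 'X).
Local Notation x := (iota2 'X).

(** The base automorphism [phi] is extended by x |-> M x. For the inverse, the entries of the
    inverse of [M] must be transported by [psi], the inverse of [phi]. *)
Lemma jonq_automorphism (M : 'M[F]_2) (N : 'M[C]_2) : \det M != 0 -> \det N != 0 ->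
  exists f g : {rmorphism L -> L},
    [/\ forall a, f (j (c a)) = j (c a) /\ g (j (c a)) = j (c a),
        f x = mob (map_mx j M) x, f (j y) = j (mob (map_mx c N) y),
        f (g x) = x /\ f (g (j y)) = j y & g (f x) = x /\ g (f (j y)) = j y].
Proof.
move=> dM dN; have uM : M \in unitmx by rewrite unitmxE unitfE.
have uN : N \in unitmx by rewrite unitmxE unitfE.
have inv_comp (K E : fieldType) (i : {rmorphism {poly K} -> E}) (A : 'M[K]_2) : is_fraction i ->
    \det A != 0 -> mob (map_mx (i \o @polyC K) (invmx A)) (mob (map_mx (i \o @polyC K) A) (i 'X)) = i 'X.
  move=> iP dA; rewrite -mobM_x // -map_mxM mulVmx ?map_mx1 ?mob1 //.
  by rewrite unitmxE unitfE.
have lift1 (A : 'M[C]_2) : \det A != 0 -> exists phi : {rmorphism F -> F},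
    (forall a, phi (c a) = c a) /\ phi y = mob (map_mx c A) y.
  by move=> dA; exact: (mob_lift iota1P idfun dA).
have dN' : \det (invmx N) != 0 by rewrite det_inv invr_eq0.
have [phi [phic phiy]] := lift1 _ dN; have [psi [psic psiy]] := lift1 _ dN'.
have mapc (h : {rmorphism F -> F}) (A : 'M[C]_2) : (forall a, h (c a) = c a) ->
    map_mx h (map_mx c A) = map_mx c A.
  by move=> hc; apply/matrixP => i k; rewrite !mxE; exact: hc.
have phipsi z : phi (psi z) = z.
  apply: (fraction_ext iota1P (f := phi \o psi) (g := idfun)) => [a|/=].
    by rewrite /= psic phic.
  by rewrite psiy rmorph_mob mapc // phiy inv_comp.
have psiphi z : psi (phi z) = z.
  apply: (fraction_ext iota1P (f := psi \o phi) (g := idfun)) => [a|/=].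
    by rewrite /= phic psic.
  rewrite phiy rmorph_mob mapc // psiy.
  by have := inv_comp _ _ _ _ iota1P dN'; rewrite invmxK.
have dM' : \det (map_mx psi (invmx M)) != 0 by rewrite det_map_mx fmorph_eq0 det_inv invr_eq0.
have [f [fj fx]] := mob_lift iota2P phi dM; have [g [gj gx]] := mob_lift iota2P psi dM'.
have mapj (h : {rmorphism L -> L}) (k : {rmorphism F -> F}) (A : 'M[F]_2) :
    (forall a, h (j a) = j (k a)) -> map_mx h (map_mx j A) = map_mx j (map_mx k A).
  by move=> hk; apply/matrixP => a b; rewrite !mxE; exact: hk.
exists f, g; split=> //; last split.
- move=> a; split; [exact: etrans (fj _) (congr1 _ (phic a))|].
  by exact: etrans (gj _) (congr1 _ (psic a)).
- by rewrite -phiy; exact: fj.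
- split; last exact: etrans (congr1 f (gj _)) (etrans (fj _) (congr1 j (phipsi _))).
  rewrite gx rmorph_mob (mapj _ _ _ fj) fx.
  have -> : map_mx phi (map_mx psi (invmx M)) = invmx M.
    by apply/matrixP => a b; rewrite !mxE phipsi.
  exact: inv_comp.
- rewrite fx rmorph_mob (mapj _ _ _ gj) gx (map_invmx psi).
  have dM2 : \det (map_mx psi M) != 0 by rewrite det_map_mx fmorph_eq0.
  have := inv_comp _ _ _ (invmx (map_mx psi M)) iota2P; rewrite invmxK; apply.
  by rewrite det_inv invr_eq0.
- exact: etrans (congr1 g (fj _)) (etrans (gj _) (congr1 j (psiphi _))).
Qed.

Context (sigma : C -> {rmorphism L -> L}).
Context (sigmaD : forall s t z, sigma (s + t) z = sigma s (sigma t z)).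
Context (sigma_cst : forall t a, sigma t (j (c a)) = j (c a)).
Context (M : C -> 'M[F]_2) (N : C -> 'M[C]_2).
Context (Mdet : forall t, \det (M t) != 0) (Ndet : forall t, \det (N t) != 0).
Context (sigmax : forall t, sigma t x = mob (map_mx j (M t)) x).
Context (sigmay : forall t, sigma t (j y) = j (mob (map_mx c (N t)) y)).
Local Notation e := (iota2 \o map_poly iota1).
Context (P0 Q0 P1 Q1 : {poly {poly {poly C}}}).
Context (PQ : cofinite (fun t => [/\ Q0.[t%:P%:P] != 0, Q1.[t%:P%:P] != 0,
  sigma t x * e Q0.[t%:P%:P] = e P0.[t%:P%:P] &
  sigma t (j y) * e Q1.[t%:P%:P] = e P1.[t%:P%:P]])).

Lemma map_mx_cst t (A : 'M[C]_2) : map_mx (sigma t) (map_mx j (map_mx c A)) = map_mx j (map_mx c A).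
Proof. by apply/matrixP => a b; rewrite !mxE; exact: sigma_cst. Qed.

Lemma j_mob (A : 'M[F]_2) z : j (mob A z) = mob (map_mx j A) (j z).
Proof. exact: (rmorph_mob (iota2 \o @polyC F)). Qed.

(** The flow fixes the constant entries of [A] and acts only on the argument, whence multiplication
    on the right. *)
Lemma sigma_mob t (A : 'M[C]_2) : sigma t (j (mob (map_mx c A) y)) = j (mob (map_mx c (A *m N t)) y).
Proof.
rewrite j_mob rmorph_mob map_mx_cst sigmay -j_mob; congr (j _).
by rewrite map_mxM mobM_x.
Qed.

Lemma N_one_parameter : one_parameter N.
Proof.
move=> s t; apply: (mob_inj iota1P) => //; first by rewrite det_mulmx mulf_neq0.
have j_inj : injective j by exact: fmorph_inj.
by apply: j_inj; rewrite -sigma_mob -sigmay -sigmay sigmaD.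
Qed.

Lemma Q_neq0 (Q : {poly {poly {poly C}}}) : (exists t, Q.[t%:P%:P] != 0) -> Q != 0.
Proof. by move=> [t]; apply: contra_neq => ->; rewrite horner0. Qed.

Lemma e_inj : injective e.
Proof.
move=> p q /iota2P.1 /polyP h; apply/polyP => i; apply: iota1P.1.
by have := h i; rewrite !coef_map.
Qed.

(** The fractions for the image of y involve x, so x is specialised to a constant [u] at which the
    leading coefficient of [Q1] in t does not vanish. *)
Lemma N_rational : exists MM, rational_family idfun N MM.
Proof.
have [n [_ Qn _ _]] := cofinite_nat PQ.
have Q10 : Q1 != 0 by apply: Q_neq0; exists n%:R.
have lQ : lead_coef Q1 != 0 by rewrite lead_coef_eq0.
have [u [v uv]] := poly2_neq0 lQ.
pose P := map_poly (horner_eval u%:P) P1; pose Q := map_poly (horner_eval u%:P) Q1.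
have E (R : {poly {poly {poly C}}}) t :
    (map_poly (horner_eval u%:P) R).[t%:P] = (R.[t%:P%:P]).[u%:P].
  by rewrite -[in LHS](hornerC t%:P u%:P) -[RHS]/(horner_eval _ _) -horner_map.
apply: (moebius_rational (P := P) (Q := Q)) => //.
  apply: contra_neq uv => Q00; rewrite lead_coefE.
  by rewrite -[(Q1`_ _).[_]]/(horner_eval _ _) -coef_map -/Q Q00 coef0 horner0.
apply: cofinite_sub PQ => t [_ _ _]; rewrite sigmay /= => et.
pose n1 : {poly C} := N t 0 0 *: 'X + (N t 0 1)%:P.
pose d1 : {poly C} := N t 1 0 *: 'X + (N t 1 1)%:P.
have d1E : iota1 d1 = c (N t 1 0) * y + c (N t 1 1) by rewrite iota_linear.
have d0 : iota1 d1 != 0 by rewrite d1E; exact: (mob_den_neq0 iota1P).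
have : n1%:P * Q1.[t%:P%:P] = d1%:P * P1.[t%:P%:P].
  apply: e_inj; rewrite [LHS]rmorphM [RHS]rmorphM /= -et.
  rewrite mulrA; congr (_ * _); rewrite !map_polyC /= -[RHS](rmorphM (iota2 \o @polyC F)).
  congr (iota2 _%:P); rewrite /mob !mxE -d1E -iota_linear mulrC divfK //.
move=> /(congr1 (horner^~ u%:P)); rewrite !hornerM !hornerC.
by rewrite /moebius_graph /P /Q !E.
Qed.

(** Here y counts as a scalar: coefficients in C[y] are mapped to [F], and x remains as the variable
    of the graph. *)
Lemma M_rational : exists MM, rational_family c M MM.
Proof.
pose h := map_poly iota1.
have hE (R : {poly {poly {poly C}}}) t : (map_poly h R).[(c t)%:P] = h R.[t%:P%:P].
  have -> : (c t)%:P = h t%:P%:P by rewrite /h map_polyC.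
  exact: horner_map.
have [n [Qn _ _ _]] := cofinite_nat PQ.
apply: (moebius_rational (P := map_poly h P0) (Q := map_poly h Q0)) => //.
  have : h Q0.[n%:R%:P%:P] != 0.
    apply: contra_neq Qn => h0; by apply: e_inj; rewrite [RHS]rmorph0 /= -/h h0 rmorph0.
  by move=> hQ; apply/eqP => Q00; case/eqP: hQ; rewrite -hE Q00 horner0.
apply: cofinite_sub PQ => t [_ _ et _]; move: et; rewrite sigmax /= => et.
rewrite /moebius_graph !hE; apply: iota2P.1; rewrite [LHS]rmorphM [RHS]rmorphM !iota_linear -et mulrA.
congr (_ * _); rewrite /mob !mxE [RHS]mulrC divfK //.
exact: (mob_den_neq0 iota2P).
Qed.

Lemma mx2_unipotent0 (K : fieldType) (b : K) : mx2 1 (0 * b) 0 1 = 1%:M.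
Proof. by apply: eqmx2; rewrite !mxE /= ?mul0r. Qed.

(** For [b = 0] every [A t] is scalar; otherwise composing [S] with the scaling by 1/b normalises
    the translation. *)
Lemma unipotent_normal_form (K E : fieldType) (iota : {rmorphism {poly K} -> E}) (io : C -> K)
    (A : C -> 'M[K]_2) S b : is_fraction iota -> \det S != 0 -> (forall t, \det (A t) != 0) ->
  (forall t, projeq (S *m A t) (mx2 1 (b * io t) 0 1 *m S)) ->
  (forall t, mob (map_mx (iota \o @polyC K) (A t)) (iota 'X) = iota 'X) \/
  exists S', \det S' != 0 /\ forall t,
    mob (map_mx (iota \o @polyC K) (S' *m A t)) (iota 'X) =
    mob (map_mx (iota \o @polyC K) S') (iota 'X) + iota (io t)%:P.
Proof.
move=> iotaP dS dA h; have uS : S \in unitmx by rewrite unitmxE unitfE.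
have [b0|b0] := eqVneq b 0; [left=> t|right].
  have [k k0] := h t; rewrite b0 mx2_unipotent0 mul1mx => /(congr1 (mulmx (invmx S))).
  rewrite mulKmx // -scalemxAr mulVmx // => ->; rewrite map_mxZ map_mx1 mobZ ?mob1 //.
  by rewrite fmorph_eq0.
pose d := mx2 b^-1 0 0 1; exists (d *m S); split.
  by rewrite det_mulmx mulf_neq0 // det2E !mxE /= mulr1 mul0r subr0 invr_eq0.
move=> t; have [k k0 e] := h t.
have -> : d *m S *m A t = k *: (mx2 1 (io t) 0 1 *m (d *m S)).
  rewrite -mulmxA e -scalemxAr !mulmxA; congr (_ *: (_ *m _)).
  by apply: eqmx2; rewrite !mulmx2E !mxE /=; field.
have dS' : \det (d *m S) != 0.
  by rewrite det_mulmx mulf_neq0 // det2E !mxE /= mulr1 mul0r subr0 invr_eq0.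
rewrite map_mxZ mobZ ?fmorph_eq0 // map_mxM mobM_x //.
have -> : map_mx (iota \o @polyC K) (mx2 1 (io t) 0 1) = mx2 1 (iota (io t)%:P) 0 1.
  by apply: eqmx2; rewrite !mxE //= ?rmorph1 ?rmorph0.
exact: mob_translation.
Qed.

Lemma base_flow : (forall t, sigma t (j y) = j y) \/
  exists S, \det S != 0 /\
    forall t, sigma t (j (mob (map_mx c S) y)) = j (mob (map_mx c S) y) + j (c t).
Proof.
have [MM MMr] := N_rational.
have [S [b [dS h]]] := one_parameter_unipotent Ndet N_one_parameter MMr.
have [e|[S' [dS' e]]] := unipotent_normal_form iota1P dS Ndet h.
  by left=> t; rewrite sigmay e.
by right; exists S'; split=> // t; rewrite sigma_mob e rmorphD.
Qed.

(** Once y is fixed, so is all of [F], and [M] becomes a one-parameter subgroup over [F];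
    nontriviality rules out the case [b = 0]. *)
Lemma fibre_flow : (forall t, sigma t (j y) = j y) -> (exists t, sigma t x != x) ->
  exists S, \det S != 0 /\
    forall t, sigma t (mob (map_mx j S) x) = mob (map_mx j S) x + j (c t).
Proof.
move=> sy [t0 st0]; have [MM MMr] := M_rational.
have sj t a : sigma t (j a) = j a.
  by apply: (fraction_ext iota1P (f := sigma t \o j) (g := j)) => [b|]; [exact: sigma_cst|exact: sy].
have smap t (A : 'M[F]_2) : sigma t (mob (map_mx j A) x) = mob (map_mx j (A *m M t)) x.
  rewrite rmorph_mob sigmax map_mxM mobM_x //; congr (mob _ _).
  by apply/matrixP => a b; rewrite !mxE; exact: sj.
have Mop : one_parameter M.
  move=> s t; apply: (mob_inj iota2P) => //; first by rewrite det_mulmx mulf_neq0.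
  by rewrite -smap -sigmax -sigmax sigmaD.
have [S [b [dS h]]] := one_parameter_unipotent Mdet Mop MMr.
have [e|[S' [dS' e]]] := unipotent_normal_form iota2P dS Mdet h.
  by move: st0; rewrite sigmax e eqxx.
by exists S'; split=> // t; rewrite smap e.
Qed.

(* Flowing a point down to the fibre eta = u gives a coordinate constant along orbits. *)
Lemma transverse_flow eta : (forall t, sigma t (j eta) = j eta + j (c t)) ->
  exists A, \det A != 0 /\ forall t, sigma t (mob (map_mx j A) x) = mob (map_mx j A) x.
Proof.
move=> seta; have [MM [dMM MMr]] := M_rational.
(* [tau] is the time in which the flow reaches the fibre eta = u; a general [u] keeps the matrix at
   that time invertible. *)
have [u du] : exists u, (\det MM).[c u - eta] != 0.
  have s0 : shift (- eta) (\det MM) != 0 by rewrite -size_poly_eq0 size_shift size_poly_eq0.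
  by have [n] := cofinite_nat (cofinite_root c s0); rewrite horner_shift; exists n%:R.
set tau := c u - eta in du.
have stau s : sigma s (j tau) = j tau - j (c s).
  by rewrite rmorphB rmorphB seta sigma_cst; ring.
exists (mxhorner MM tau); split; first by rewrite det_map_mx.
move=> s; pose row i : {poly L} := map_poly j (MM i 0) * x%:P + map_poly j (MM i 1).
have rowE i z : (row i).[j z] = j (MM i 0).[z] * x + j (MM i 1).[z].
  by rewrite hornerD hornerM hornerC !horner_map.
have sx t : projeq (M t) (mxhorner MM (c t)) ->
    (row 1).[j (c t)] != 0 /\ sigma t x = (row 0).[j (c t)] / (row 1).[j (c t)].
  move=> pt; have dt : \det (mxhorner MM (c t)) != 0.
    have [k k0 e] := pt; have := Mdet t; rewrite e detZ mulf_eq0 negb_or.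
    by case/andP.
  rewrite !rowE -!mxhornerE; split; first exact: (mob_den_neq0 iota2P).
  rewrite sigmax; have [k k0 ->] := pt; rewrite map_mxZ mobZ ?fmorph_eq0 //.
  by rewrite /mob !mxE.
(* The flow law for x, as a polynomial identity in t over [L]: it may then be evaluated at
   parameters that are not constants. *)
have E : map_poly (sigma s) (row 0) * shift (j (c s)) (row 1) =
         shift (j (c s)) (row 0) * map_poly (sigma s) (row 1).
  apply: (cofinite_poly_eq (io := j \o c)).
  apply: cofinite_sub2 MMr (cofinite_shift s MMr) => t /sx[d0 e0] /sx[d1 e1].
  have sE i : (map_poly (sigma s) (row i)).[j (c t)] = sigma s (row i).[j (c t)].
    by rewrite -[in LHS](sigma_cst s t) horner_map.
  have shE i : (row i).[j (c t) + j (c s)] = (row i).[j (c (t + s))].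
    by congr (_.[_]); rewrite -[LHS]rmorphD -[c t + c s]rmorphD.
  rewrite [LHS]hornerM [RHS]hornerM 2!sE 2!horner_shift 2!shE.
  have s1 : sigma s (row 1).[j (c t)] != 0 by rewrite fmorph_eq0.
  have := sigmaD s t x; rewrite addrC e0 e1 fmorph_div => /eqP.
  by rewrite eqr_div // => /eqP ->.
(* At t = sigma_s tau = tau - s, the left factor of each product gives the image of a row under
   [sigma s], and the shift by s brings the parameter back to tau. *)
have := congr1 (horner^~ (sigma s (j tau))) E.
rewrite /= [X in X = _]hornerM [X in _ = X]hornerM 2!horner_map 2!horner_shift stau subrK.
have t1 : (row 1).[j tau] != 0.
  rewrite rowE -!mxhornerE; apply: (mob_den_neq0 iota2P).
  by rewrite det_map_mx.
have xiE : mob (map_mx j (mxhorner MM tau)) x = (row 0).[j tau] / (row 1).[j tau].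
  by rewrite /mob !mxE !rowE.
move=> e; rewrite xiE fmorph_div; apply/eqP; rewrite eqr_div ?fmorph_eq0 //.
by rewrite e mulrC.
Qed.

Lemma flow_normal_form : (exists t, sigma t x != x \/ sigma t (j y) != j y) ->
  exists A B, [/\ \det A != 0, \det B != 0 &
    let xi := mob (map_mx j A) x in let eta := j (mob (map_mx c B) y) in
    (forall t, sigma t xi = xi + j (c t) /\ sigma t eta = eta) \/
    (forall t, sigma t xi = xi /\ sigma t eta = eta + j (c t))].
Proof.
move=> [t0 nt]; have [sy|[B [dB sB]]] := base_flow.
  have [|A [dA sA]] := fibre_flow sy.
    by exists t0; case: nt => //; rewrite sy eqxx.
  exists A, 1%:M; split; rewrite ?det1 ?oner_eq0 //=; left=> t.
  by rewrite map_mx1 mob1; split; [exact: sA|exact: sy].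
have [A [dA sA]] := transverse_flow sB.
by exists A, B; split=> //; right=> t; split; [exact: sA|exact: sB].
Qed.

End JonquieresFlow.

(** * Classification *)
Lemma fraction_gen (F L : fieldType) (iota : {rmorphism {poly F} -> L}) (S : L -> Prop) :
  is_fraction iota -> (forall a, S (iota a%:P)) -> S (iota 'X) ->
  (forall a b, S a -> S b -> S (a + b)) -> (forall a b, S a -> S b -> S (a * b)) ->
  (forall a, a != 0 -> S a -> S a^-1) -> forall z, S z.
Proof.
move=> iotaP Sc Sx SD SM SV; have SP p : S (iota p).
  elim/poly_ind: p => [|p c IH]; first by rewrite -polyC0.
  by rewrite rmorphD rmorphM; apply: SD => //; exact: SM.
move=> z; have [p [q [q0 ->]]] := iotaP.2 z.
by apply: SM => //; apply: SV => //; exact: (iota_neq0 iotaP).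
Qed.

Section Classification.
Context (C : numClosedFieldType) (F L : fieldType).
Context (iota1 : {rmorphism {poly C} -> F}) (iota1P : is_fraction iota1).
Context (iota2 : {rmorphism {poly F} -> L}) (iota2P : is_fraction iota2).
Local Notation c := (iota1 \o @polyC C).
Local Notation j := (iota2 \o @polyC F).
Local Notation y := (iota1 'X).
Local Notation x := (iota2 'X).
Local Notation e := (iota2 \o map_poly iota1).

(** [F] and [L] are abstract models of C(y) and C(y)(x); actual fraction fields are substituted only
    at the end. *)
Definition dehom : {rmorphism {mpoly C[3]} -> L} := e \o @chart C.

Lemma chartX (i : 'I_3) : chart 'X_i = tnth [tuple 'X; 'X%:P; 1] i :> {poly {poly C}}.
Proof. by rewrite /chart mmapX mmap1U. Qed.

Lemma dehomC a : dehom a%:MP = j (c a).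
Proof. by rewrite /dehom /= /chart mmapC /cst2 !map_polyC. Qed.

Lemma dehomX0 : dehom 'X_0 = x.
Proof. by rewrite /dehom /= chartX (tnth_nth 0) /= map_polyX. Qed.

Lemma dehomX1 : dehom 'X_1 = j y.
Proof. by rewrite /dehom /= chartX (tnth_nth 0) /= map_polyC. Qed.

Lemma dehomX2 : dehom 'X_2 = 1.
Proof. by rewrite /dehom /= chartX (tnth_nth 0) /= !rmorph1. Qed.

Lemma dehom_inj d p : p \is d.-homog -> dehom p = 0 -> p = 0.
Proof.
move=> hp; rewrite -(rmorph0 e) => /(e_inj iota1P iota2P); exact: (chart_inj hp).
Qed.

Lemma dehom_gen (S : L -> Prop) : (forall a, S (dehom a%:MP)) -> S (dehom 'X_0) -> S (dehom 'X_1) ->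
  (forall a b, S a -> S b -> S (a + b)) -> (forall a b, S a -> S b -> S (a * b)) ->
  (forall a, a != 0 -> S a -> S a^-1) -> forall z, S z.
Proof.
rewrite dehomX0 dehomX1 => Sc Sx Sy SD SM SV; apply: (fraction_gen iota2P) => // a.
apply: (fraction_gen (S := fun a => S (j a)) iota1P) => // [b|b b'|b b'|b b0 Sb].
- by rewrite -[j _]/(j (c b)) -dehomC.
- by rewrite rmorphD; exact: SD.
- by rewrite rmorphM; exact: SM.
- by rewrite fmorphV; apply: SV => //; rewrite fmorph_eq0.
Qed.

Lemma aptD s t : apt (s + t) = (apt s : 'rV[C]_1) + (apt t : 'rV[C]_1).
Proof. by apply/matrixP => i k; rewrite !mxE. Qed.

Definition jonq_form (f : Bir C) := exists (A : 'M[F]_2) (B : 'M[C]_2), [/\ \det A != 0, \det B != 0 &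
  aff dehom f = ((j (A 0 0) * x + j (A 0 1)) / (j (A 1 0) * x + j (A 1 1)),
    (j (c (B 0 0)) * j y + j (c (B 0 1))) / (j (c (B 1 0)) * j y + j (c (B 1 1))))].

Lemma jonq_formE f : jonq_form f <-> exists A B, [/\ \det A != 0, \det B != 0 &
  aff dehom f = (mob (map_mx j A) x, j (mob (map_mx c B) y))].
Proof.
by split=> -[A [B [dA dB E]]]; exists A, B; split; rewrite // E j_mob /mob !mxE.
Qed.

(** The natural structure turns the parametrisation of [G] by the line into a morphism to Bir, hence
    a flow rational in t; the Jonquieres map with pullback x |-> xi, y |-> eta conjugates it to
    translations. *)
Lemma Ga_normal_form (G : set (Bir C)) : isomorphic_to_Ga G -> (forall f, G f -> jonq_form f) ->
  exists h, jonq_form h /\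
   ([set (h * g * h^-1)%g | g in G] = [set f | exists a, aff dehom f = (x + j (c a), j y)] \/
    [set (h * g * h^-1)%g | g in G] = [set f | exists a, aff dehom f = (x, j y + j (c a))]).
Proof.
move=> [X [pi [piX [psi [theta [iso thetaD]]]]]] GJ.
have theta_morph : morphism theta by case: iso.
have theta_bir := (ns_morphism piX theta (variety_A1 C) (irreducible_A1 C)).1 theta_morph.
have [P0 [Q0 [P1 [Q1 PQ]]]] := bir_morphism_rational theta_bir.
have [pull [pullE pullC pullM]] := pull_exists dehom_inj dehomX2 dehom_gen.
rewrite dehomX0 dehomX1 in pullE.
have aff_injective := aff_inj dehom_inj.
pose th t := pi (theta (apt t)); pose sigma t := pull (th t).
have thD s t : th (s + t) = (th s * th t)%g by rewrite /th aptD thetaD.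
have thG t : G (th t) by case: (ns_bij piX) => + _ _; apply.
have Gth g : G g -> exists t, g = th t.
  case: (ns_bij piX) => _ _ /[apply] -[p _ <-].
  case: iso => _ _ _ _ [/(_ p I)[_ pE] _].
  by have [t tE] := aptP (psi p); exists t; rewrite /th -tE pE.
have th_inj s t : th s = th t -> s = t.
  case: (ns_bij piX) => _ inj _ /inj E.
  have {}E : theta (apt s) = theta (apt t) by apply: E; rewrite inE.
  have := congr1 psi E; case: iso => _ _ _ _ [_ k].
  rewrite (k _ I).2 (k _ I).2 => /matrixP/(_ 0 0).
  by rewrite !mxE.
(* Pullback reverses products; commutativity of the parameters restores the order. *)
have sigmaD s t z : sigma (s + t) z = sigma s (sigma t z).
  by rewrite addrC /sigma thD pullM.
have sigma_cst t a : sigma t (j (c a)) = j (c a) by rewrite -dehomC pullC.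
have thJ t := cid ((jonq_formE _).1 (GJ _ (thG t))); have thJ' t := cid (projT2 (thJ t)).
pose M t := projT1 (thJ t); pose N t := projT1 (thJ' t).
have MN t : [/\ \det (M t) != 0, \det (N t) != 0 &
    aff dehom (th t) = (mob (map_mx j (M t)) x, j (mob (map_mx c (N t)) y))] := projT2 (thJ' t).
have Mdet t : \det (M t) != 0 by case: (MN t).
have Ndet t : \det (N t) != 0 by case: (MN t).
have sigmax t : sigma t x = mob (map_mx j (M t)) x.
  by have [_ _] := MN t; rewrite pullE => -[].
have sigmay t : sigma t (j y) = j (mob (map_mx c (N t)) y).
  by have [_ _] := MN t; rewrite pullE => -[].
have quot (a b u p q : L) : b != 0 -> a / b = u -> a * q = p * b -> u * q = p.
  by move=> b0 <- E; apply: (mulIf b0); rewrite -E mulrAC divfK.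
have F2 t : dehom (tnth (frep (th t)) 2) != 0 by exact: (D_fwd2 dehom_inj).
have PQ' : cofinite (fun t => [/\ Q0.[t%:P%:P] != 0, Q1.[t%:P%:P] != 0,
    sigma t x * e Q0.[t%:P%:P] = e P0.[t%:P%:P] &
    sigma t (j y) * e Q1.[t%:P%:P] = e P1.[t%:P%:P]]).
  apply: cofinite_sub PQ => t /= [q0 q1 E0 E1]; split=> //.
  - apply: quot (F2 t) (congr1 fst (pullE (th t))) _.
    by move/(congr1 e): E0; rewrite [LHS]rmorphM [RHS]rmorphM.
  - apply: quot (F2 t) (congr1 snd (pullE (th t))) _.
    by move/(congr1 e): E1; rewrite [LHS]rmorphM [RHS]rmorphM.
(* By injectivity [th 1] differs from [th 0], and a birational map is determined by its affine
   coordinates. *)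
have nontriv : exists t, sigma t x != x \/ sigma t (j y) != j y.
  exists 1; apply: contrapT => /not_orP[/negP/negPn/eqP e1 /negP/negPn/eqP e2].
  have := oner_neq0 C; apply/negP/negPn/eqP; apply: th_inj; apply: aff_injective.
  rewrite !pullE -/(sigma _) -/(sigma _) e1 e2.
  have s0 z : sigma 0 z = z.
    by apply: (fmorph_inj (sigma 0)); rewrite -sigmaD addr0.
  by rewrite !s0.
have [A [B [dA dB fl]]] :=
  flow_normal_form iota1P iota2P sigmaD sigma_cst Mdet Ndet sigmax sigmay PQ' nontriv.
have [f [g [fgc fx fy [fgx fgy] [gfx gfy]]]] := jonq_automorphism iota1P iota2P dA dB.
have [h hE] : exists h, aff dehom h = (f x, f (j y)).
  have := bir_of_automorphism dehom_inj dehomX2 dehom_gen (Phi := f) (Psi := g).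
  rewrite dehomX0 dehomX1; apply => //.
  - by move=> a; rewrite dehomC; case: (fgc a).
  - by move=> a; rewrite dehomC; case: (fgc a).
have hx : pull h x = mob (map_mx j A) x by rewrite -fx; have := hE; rewrite pullE => -[].
have hy : pull h (j y) = j (mob (map_mx c B) y) by rewrite -fy; have := hE; rewrite pullE => -[].
have pull1 z : pull 1%g z = z.
  by apply: (fmorph_inj (pull 1%g)); rewrite -pullM mulg1.
have hV z : pull h^-1%g (pull h z) = z by rewrite -pullM mulgV pull1.
have hVc a : pull h^-1%g (j (c a)) = j (c a) by rewrite -dehomC pullC.
have hVx : pull h^-1%g (mob (map_mx j A) x) = x by rewrite -hx hV.
have hVy : pull h^-1%g (j (mob (map_mx c B) y)) = j y by rewrite -hy hV.
(* From right to left: x goes to xi, then the flow acts, and the pullback by the inverse of [h]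
   returns xi to x; likewise for y and eta. *)
have conjE t z : pull (h * th t * h^-1)%g z = pull h^-1%g (sigma t (pull h z)).
  by rewrite !pullM.
exists h; split; first by apply/jonq_formE; exists A, B; rewrite hE fx fy.
move: fl => /= [fl|fl]; [left|right].
  have affE t : aff dehom (h * th t * h^-1)%g = (x + j (c t), j y).
    by rewrite pullE !conjE hx hy (fl t).1 (fl t).2 rmorphD hVx hVy hVc.
  apply/seteqP; split=> [_ [k /Gth[t ->] <-]|k [a ka]]; first by exists t.
  by exists (th a); [exact: thG|apply: aff_injective; rewrite affE ka].
have affE t : aff dehom (h * th t * h^-1)%g = (x, j y + j (c t)).
  by rewrite pullE !conjE hx hy (fl t).1 (fl t).2 rmorphD hVx hVy hVc.
apply/seteqP; split=> [_ [k /Gth[t ->] <-]|k [a ka]]; first by exists t.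
by exists (th a); [exact: thG|apply: aff_injective; rewrite affE ka].
Qed.

End Classification.

(** * Return to the fraction fields of the definitions *)

Lemma tofrac_is_fraction (F : fieldType) :
  is_fraction (@FracField.tofrac {poly F} : {rmorphism {poly F} -> {fraction {poly F}}}).
Proof.
split; first by move=> p q /eqP; rewrite tofrac_eq => /eqP.
by move=> z; have [p [q [q0 zE]]] := fractionP z; exists p, q.
Qed.

Section Concrete.
Context (C : numClosedFieldType).
Local Notation iota1 := (@FracField.tofrac {poly C} : {rmorphism {poly C} -> {fraction {poly C}}}).
Local Notation iota2 := (@FracField.tofrac {poly {fraction {poly C}}}
  : {rmorphism {poly {fraction {poly C}}} -> {fraction {poly {fraction {poly C}}}}}).

Lemma affine_formE (f : Bir C) : affine_form f = aff (dehom iota1 iota2) f.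
Proof.
have E p : dehomogenize p = dehom iota1 iota2 p by rewrite -poly_in_chart.
by rewrite /affine_form /aff /frep; congr (_ / _, _ / _); exact: E.
Qed.

Lemma JonqE (f : Bir C) : Jonq f <-> jonq_form iota1 iota2 f.
Proof.
split=> -[A [B []]]; rewrite ?unitmxE ?unitfE => hA hB E; exists A, B.
  by split=> //; exact: etrans (esym (affine_formE f)) E.
split; [by rewrite unitmxE unitfE|by rewrite unitmxE unitfE|].
exact: etrans (affine_formE f) E.
Qed.

Lemma Ga_conjugate (G : set (Bir C)) : G `<=` @Jonq C -> isomorphic_to_Ga G ->
  exists h : Bir C, Jonq h /\
    ([set (h * g * h^-1)%g | g in G] = @U1 C \/ [set (h * g * h^-1)%g | g in G] = @U2 C).
Proof.
move=> GJ hGa; have [h [hJ hE]] := Ga_normal_form (tofrac_is_fraction _) (tofrac_is_fraction _) hGa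
  (fun f Gf => (JonqE f).1 (GJ f Gf)).
exists h; split; first exact/JonqE.
case: hE => ->; [left|right]; apply/seteqP; split=> f [a E]; exists a.
- exact: etrans (affine_formE f) E.
- exact: etrans (esym (affine_formE f)) E.
- exact: etrans (affine_formE f) E.
- exact: etrans (esym (affine_formE f)) E.
Qed.

End Concrete.

Theorem proposition9p1 (R : realType) (G : set (Bir R[i]))
    (hG : algebraic_subgroup G) (hJonq : G `<=` @Jonq R[i])
    (hGa : isomorphic_to_Ga G) :
  exists h : Bir R[i], Jonq h /\
    ([set (h * g * h^-1)%g | g in G] = @U1 R[i] \/
     [set (h * g * h^-1)%g | g in G] = @U2 R[i]).
Proof. exact: Ga_conjugate hJonq hGa. Qed.
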